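(* Let $\mathbf{X}^*\in\mathbb{R}^{n_1\times n_2}$ have rank $r$ and condition number $\kappa=\sigma_1(\mathbf{X}^* )/\sigma_r(\mathbf{X}^* )$, with skinny SVD $\mathbf{U}\mathbf{\Sigma}\mathbf{V}^T$, and suppose $\mathbf{X}^*$ obeys $\mu$-incoherence: $\|\mathbf{U}^T\mathbf{e}_i\|_2\le\sqrt{\mu r/n_1}$ and $\|\mathbf{V}^T\mathbf{e}_i\|_2\le\sqrt{\mu r/n_2}$ for all $i$. Let $\Omega\subseteq[n_1]\times[n_2]$ be drawn uniformly at random among all subsets of cardinality $m$. There are absolute constants $c$ and $c_0$ such that, provided $m\ge c\kappa^2\mu rn_{(1)}\log_{2\kappa}(n_{(1)})\log(n_{(1)})$, with probability at least $1-c_0n_{(1)}^{-10}$ the convex problem $$\widetilde{\mathbf{X}}=\arg\min_{\mathbf{X}}\|\mathbf{X}\|_{r*}\quad\text{s.t.}\quad\mathcal{P}_\Omega(\mathbf{X})=\mathcal{P}_\Omega(\mathbf{X}^* )$$ has a unique solution and it satisfies $\widetilde{\mathbf{X}}=\mathbf{X}^*$; moreover, strong duality holds for the non-convex problem $\min_{\mathbf{A}\in\mathbb{R}^{n_1\times r},\mathbf{B}\in\mathbb{R}^{r\times n_2}}\frac{1}{2}\|\mathbf{A}\mathbf{B}\|_F^2$ s.t. $\mathcal{P}_\Omega(\mathbf{A}\mathbf{B})=\mathcal{P}_\Omega(\mathbf{X}^* )$.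
   Context: $n_{(1)}=\max\{n_1,n_2\}$. $\mathcal{P}_\Omega$ keeps the entries indexed by $\Omega$ and zeroes the rest. For a matrix $\mathbf{M}$, $\|\mathbf{M}\|_r^2=\sum_{i=1}^r\sigma_i^2(\mathbf{M})$ (sum of the $r$ largest squared singular values), and $\|\mathbf{M}\|_{r*}=\max_{\mathbf{X}}\langle\mathbf{M},\mathbf{X}\rangle-\frac{1}{2}\|\mathbf{X}\|_r^2$. Strong duality for the non-convex problem means: writing it as $\min_{\mathbf{A},\mathbf{B}}H(\mathbf{A}\mathbf{B})+\frac12\|\mathbf{A}\mathbf{B}\|_F^2$ with $H$ the indicator function ($0$ or $+\infty$) of $\{\mathbf{M}:\mathcal{P}_\Omega\mathbf{M}=\mathcal{P}_\Omega\mathbf{X}^*\}$, one has $\min_{\mathbf{A},\mathbf{B}}\max_{\mathbf{\Lambda}}L=\max_{\mathbf{\Lambda}}\min_{\mathbf{A},\mathbf{B}}L$ for $L(\mathbf{A},\mathbf{B},\mathbf{\Lambda})=\frac{1}{2}\|-\mathbf{\Lambda}-\mathbf{A}\mathbf{B}\|_F^2-\frac{1}{2}\|\mathbf{\Lambda}\|_F^2-H^*(\mathbf{\Lambda})$, $H^*$ the convex conjugate. *)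

(* Defs.v *)
(* Indices 1, .., n are rendered by 'I_n, and singular values are indexed from 0. *)
From HB Require Import structures.
From mathcomp Require Import all_boot all_order all_algebra.
From mathcomp Require Import polyrcf.
From mathcomp Require Import all_classical all_reals all_analysis.

Set Implicit Arguments.
Unset Strict Implicit.
Unset Printing Implicit Defensive.

Import Order.TTheory GRing.Theory Num.Theory.

Local Open Scope classical_set_scope.
Local Open Scope ring_scope.

Section Matrices.
Variable R : realType.

(* Real eigenvalues repeated according to their algebraic multiplicity; for a
   symmetric matrix these are all the eigenvalues. *)
Definition eigenvalues n (A : 'M[R]_n) : seq R :=
  flatten [seq nseq (mup x (char_poly A)) x | x <- rootsR (char_poly A)].

Lemma count_eigenvalues n (A : 'M[R]_n) (x : R) :
  count_mem x (eigenvalues A) = mup x (char_poly A).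
Proof.
have p0 : char_poly A != 0 by exact/monic_neq0/char_poly_monic.
have rP : (x \in rootsR (char_poly A)) = root (char_poly A) x.
  by have := roots_on_rootsR p0 x; rewrite in_itv.
have : uniq (rootsR (char_poly A)) by exact: uniq_roots.
rewrite /eigenvalues count_flatten -map_comp /comp.
rewrite (eq_map (g := fun y => (y == x) * mup y (char_poly A))%N); last first.
  by move=> y; rewrite count_nseq /= .
have [xr|xr] := boolP (root (char_poly A) x); last first.
  rewrite (mupNroot xr) => _; move: xr; rewrite -rP.
  elim: (rootsR _) => //= y l IH; rewrite inE negb_or => /andP[xy xl].
  by rewrite IH // eq_sym (negbTE xy).
move: xr; rewrite -rP.
elim: (rootsR _) => //= y l IH; rewrite inE => /orP[/eqP <- /andP[xl _]|xl].
  rewrite eqxx mul1n; suff -> : sumn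
    [seq ((z == x) * mup z (char_poly A))%N | z <- l] = 0%N by rewrite addn0.
  elim: l xl {IH} => //= z l IH; rewrite inE negb_or => /andP[xz xl].
  by rewrite IH // eq_sym (negbTE xz).
move=> /andP[yl ul]; rewrite IH //.
by case: eqP yl => // ->; rewrite xl.
Qed.

Definition singular_values n1 n2 (M : 'M[R]_(n1, n2)) : seq R :=
  sort >=%R [seq Num.sqrt x | x <- eigenvalues (M^T *m M)].

(* sigma M i is the (i+1)-st largest singular value.  There are n2 of them
   here; the ones past min (n1, n2) vanish, and so does the nth default. *)
Definition sigma n1 n2 (M : 'M[R]_(n1, n2)) (i : nat) : R :=
  (singular_values M)`_i.

Definition condition_number n1 n2 (M : 'M[R]_(n1, n2)) : R :=
  sigma M 0 / sigma M (\rank M).-1.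

Definition inner n1 n2 (M N : 'M[R]_(n1, n2)) : R := \tr (M^T *m N).

(* Frobenius norm, the Euclidean norm on column vectors; the library norm
   `|M| on matrices is the max norm. *)
Definition fnorm n1 n2 (M : 'M[R]_(n1, n2)) : R :=
  Num.sqrt (\sum_i \sum_j M i j ^+ 2).

Definition skinny_svd n1 n2 r (X : 'M[R]_(n1, n2))
    (U : 'M[R]_(n1, r)) (s : 'rV[R]_r) (V : 'M[R]_(n2, r)) : Prop :=
  [/\ U^T *m U = 1%:M, V^T *m V = 1%:M,
      forall i, 0 < s 0 i,
      forall i j : 'I_r, (i <= j)%N -> s 0 j <= s 0 i &
      X = U *m diag_mx s *m V^T].

Definition incoherent n1 n2 r (mu : R)
    (U : 'M[R]_(n1, r)) (V : 'M[R]_(n2, r)) : Prop :=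
  (forall i : 'I_n1,
     fnorm (U^T *m (delta_mx i 0 : 'cV_n1)) <= Num.sqrt (mu * r%:R / n1%:R)) /\
  (forall i : 'I_n2,
     fnorm (V^T *m (delta_mx i 0 : 'cV_n2)) <= Num.sqrt (mu * r%:R / n2%:R)).

Definition proj_Omega n1 n2 (Omega : {set 'I_n1 * 'I_n2}) (M : 'M[R]_(n1, n2)) :
    'M[R]_(n1, n2) :=
  \matrix_(i, j) (if (i, j) \in Omega then M i j else 0).

(* The square of the norm ||M||_r. *)
Definition rnorm2 n1 n2 (r : nat) (M : 'M[R]_(n1, n2)) : R :=
  \sum_(i < r) sigma M i ^+ 2.

Definition rstar n1 n2 (r : nat) (M : 'M[R]_(n1, n2)) : \bar R :=
  ereal_sup [set (inner M X - 2^-1 * rnorm2 r X)%:E | X in [set: 'M[R]_(n1, n2)]].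

Definition argmin T (f : T -> \bar R) (D : set T) : set T :=
  [set x | D x /\ forall y, D y -> (f x <= f y)%E].

Definition feasible n1 n2 (Omega : {set 'I_n1 * 'I_n2}) (X : 'M[R]_(n1, n2)) :
    set 'M[R]_(n1, n2) :=
  [set M | proj_Omega Omega M = proj_Omega Omega X].

Definition indicator T (D : set T) (x : T) : \bar R :=
  if x \in D then 0%E else +oo%E.

Definition conjugate n1 n2 (H : 'M[R]_(n1, n2) -> \bar R)
    (Lam : 'M[R]_(n1, n2)) : \bar R :=
  ereal_sup [set ((inner Lam M)%:E - H M)%E | M in [set: 'M[R]_(n1, n2)]].

Definition lagrangian n1 n2 r (H : 'M[R]_(n1, n2) -> \bar R)
    (A : 'M[R]_(n1, r)) (B : 'M[R]_(r, n2)) (Lam : 'M[R]_(n1, n2)) : \bar R :=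
  ((2^-1 * fnorm (- Lam - A *m B) ^+ 2 - 2^-1 * fnorm Lam ^+ 2)%:E
   - conjugate H Lam)%E.

(* The inner optimizations are a supremum and an infimum in \bar R: the inner
   supremum is +oo, hence not a maximum, when H (A *m B) = +oo. *)
Definition primal_value n1 n2 r (H : 'M[R]_(n1, n2) -> \bar R)
    (AB : 'M[R]_(n1, r) * 'M[R]_(r, n2)) : \bar R :=
  ereal_sup (range (lagrangian H AB.1 AB.2)).

Definition dual_value n1 n2 r (H : 'M[R]_(n1, n2) -> \bar R)
    (Lam : 'M[R]_(n1, n2)) : \bar R :=
  ereal_inf [set lagrangian H AB.1 AB.2 Lam
            | AB in [set: 'M[R]_(n1, r) * 'M[R]_(r, n2)]].

Definition is_min (S : set (\bar R)) (v : \bar R) : Prop := S v /\ lbound S v.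
Definition is_max (S : set (\bar R)) (v : \bar R) : Prop := S v /\ ubound S v.

(* min max = max min, with both outer optima attained. *)
Definition strong_duality n1 n2 (r : nat) (H : 'M[R]_(n1, n2) -> \bar R) :
    Prop :=
  exists v : \bar R,
    is_min (range (primal_value (r := r) H)) v /\
    is_max (range (dual_value r H)) v.

(* Probability of E for a uniformly random m-element subset of
   'I_n1 * 'I_n2; meaningful for m <= n1 * n2. *)
Definition uniform_pr n1 n2 (m : nat) (E : {set 'I_n1 * 'I_n2} -> Prop) : R :=
  #|[pred Omega : {set 'I_n1 * 'I_n2} | (#|Omega| == m) && `[< E Omega >]]|%:R /
  #|[pred Omega : {set 'I_n1 * 'I_n2} | #|Omega| == m]|%:R.

(* Logarithm of x in base b. *)
Definition logb (b x : R) : R := ln x / ln b.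

End Matrices.

(* Main.v *)
(* Let T be the tangent space at Xs of the matrices of rank r. If some Y
   supported on Omega satisfies P_T Y = Xs and |P_{T^perp} Y| < sigma_r, and if
   no nonzero element of T vanishes on Omega, then Y has the same r largest
   singular values as Xs. Testing the supremum in |.|_{r*} at Y and at small
   perturbations of Y in T^perp gives uniqueness, and -Y is an optimal dual
   variable by Eckart-Young.

   Y is built by golfing over k ~ 2 log_{2 kappa} n independent Bernoulli
   batches. One step maps a residual Z in T to Z - P_T (P_S Z) / q and must
   contract the entries, the rows and the columns of Z by 1 / (8 kappa) while
   controlling the operator norm of P_S Z / q - Z. All these are tail bounds
   for sums of independent centered terms. They follow from the moment method:
   the 2p-th moment (respectively E tr (D D^T)^p) is a sum over words
   (respectively closed walks) in the entries, only words in which every letter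
   occurs at least twice contribute, and building a word letter by letter costs
   at most a factor 4p per letter. With p ~ log n this is Bernstein's inequality
   up to constants.

   Golfing from every P_T (e_i e_j^T) as well shows that P_Omega is injective on
   T and provides matrices supported on Omega that correct the last residual
   exactly. Finally failure is monotone in Omega, so that a uniform set of size
   m fails at most twice as often as a Bernoulli set of mean size m / 2. *)
From HB Require Import structures.
Require Import Defs.
From mathcomp Require Import all_boot all_order all_algebra.
From mathcomp Require Import perm ring lra.
From mathcomp Require Import all_classical all_reals all_analysis.
From mathcomp Require Import complex.

Set Implicit Arguments.
Unset Strict Implicit.
Unset Printing Implicit Defensive.

Import Order.TTheory GRing.Theory Num.Theory.

Local Open Scope ring_scope.

(** * Bernoulli sampling *)

(** Sample sizes linear in [n] come from measuring a residual by entries and lines at once. With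
    [w ^+ 2] of order [mu r n / (n1 n2)], the matrix to recover has entries at most [s1 * w ^+ 2]
    and rows and columns of norm at most [s1 * w]; line norms control the variance of the row,
    column and spectral tails, entries the largest term. One condition, [w ^+ 2 * log n] at most of
    order [th ^+ 2 * q], then serves every tail. A step from line norm [b] costs [th * b / w] in
    operator norm, that is [th * s1] for the first one; keeping this below [sigma_r] forces [th] of
    order [1 / kappa], whence the factor [kappa ^ 2] and the base [2 kappa] of the logarithm.

    Golfing is often completed by a concentration bound for [P_T - q^-1 P_T P_Omega P_T] as an
    operator on matrices. Golfing from all matrix units needs only entrywise bounds instead: the
    union bound costs a power of [n], absorbed by [K], and the last residual is removed by inverting
    a map that is within 1/2 of the identity in the entrywise l1 norm. *)

Section Bernoulli.
Variables (R : realFieldType) (E : finType).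
Implicit Types (q : R) (f g : {set E} -> R) (S : {set E}).

Definition bweight q S : R := \prod_e (if e \in S then q else 1 - q).

Definition bern q f : R := \sum_S bweight q S * f S.

Lemma bweight_card q S : bweight q S = q ^+ #|S| * (1 - q) ^+ #|~: S|.
Proof.
rewrite /bweight (bigID (mem S)) /=; congr (_ * _).
  by rewrite (eq_bigr (fun=> q)) ?prodr_const // => e ->.
rewrite (eq_bigr (fun=> 1 - q)) => [|e /negbTE -> //].
by rewrite prodr_const; congr (_ ^+ _); apply: eq_card => e; rewrite !inE.
Qed.

Lemma bern_prod q (g : E -> bool -> R) :
  bern q (fun S => \prod_e g e (e \in S)) =
  \prod_e (q * g e true + (1 - q) * g e false).
Proof.
rewrite bigA_distr /bern; apply: eq_bigr => S _.
rewrite /bweight -big_split /=; apply: eq_bigr => e _.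
by case: (e \in S).
Qed.

Lemma bern_cst q c : bern q (fun=> c) = c.
Proof.
suff H : \sum_S bweight q S = 1 by rewrite /bern -mulr_suml H mul1r.
have := bern_prod q (fun _ _ => 1).
rewrite [in RHS]big1 => [<-|e _]; last by rewrite !mulr1 addrC subrK.
by apply: eq_bigr => S _; rewrite big1_eq mulr1.
Qed.

Lemma bern_sum q (I : Type) (r : seq I) (P : pred I) (F : I -> {set E} -> R) :
  bern q (fun S => \sum_(i <- r | P i) F i S) =
  \sum_(i <- r | P i) bern q (F i).
Proof.
by rewrite exchange_big /=; apply: eq_bigr => S _; rewrite big_distrr.
Qed.

Lemma bernD q f g : bern q (fun S => f S + g S) = bern q f + bern q g.
Proof. by rewrite -big_split; apply: eq_bigr => S _; rewrite mulrDr. Qed.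

Lemma bernZ q c f : bern q (fun S => c * f S) = c * bern q f.
Proof. by rewrite big_distrr; apply: eq_bigr => S _; rewrite mulrCA. Qed.

Lemma eq_bern q f g : f =1 g -> bern q f = bern q g.
Proof. by move=> fg; apply: eq_bigr => S _; rewrite fg. Qed.

Section Monotone.
Variable q : R.
Hypothesis q01 : 0 <= q <= 1.

Lemma bweight_ge0 S : 0 <= bweight q S.
Proof.
apply: prodr_ge0 => e _; case: ifP => _; first by case/andP: q01.
by rewrite subr_ge0; case/andP: q01.
Qed.

Lemma le_bern f g : (forall S, f S <= g S) -> bern q f <= bern q g.
Proof. by move=> fg; apply: ler_sum => S _; rewrite ler_wpM2l ?bweight_ge0. Qed.

Lemma bern_markov (P : pred {set E}) f (c : R) : 0 < c ->
  (forall S, 0 <= f S) -> (forall S, P S -> c <= f S) ->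
  bern q (fun S => (P S)%:R) <= bern q f / c.
Proof.
move=> c0 f0 Pf; rewrite ler_pdivlMr // mulrC -bernZ; apply: le_bern => S.
by case: (boolP (P S)) => [/Pf|_]; rewrite ?mulr1 ?mulr0.
Qed.

Lemma bern_union_bound (I : finType) (P : pred {set E})
    (Q : I -> pred {set E}) :
  (forall S, P S -> exists i, Q i S) ->
  bern q (fun S => (P S)%:R) <= \sum_i bern q (fun S => (Q i S)%:R).
Proof.
move=> PQ; rewrite -bern_sum; apply: le_bern => S.
case: (boolP (P S)) => [/PQ[i Qi]|_]; last by apply: sumr_ge0 => i _.
by rewrite (bigD1 i) //= Qi lerDl sumr_ge0.
Qed.

End Monotone.

Lemma bern_card q : bern q (fun S => #|S|%:R) = q * #|E|%:R.
Proof.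
transitivity (bern q (fun S => \sum_e (e \in S)%:R)).
  apply: eq_bern => S; rewrite -natr_sum -sum1_card; congr _%:R.
  by rewrite [RHS]big_mkcond /= [LHS]big_mkcond; apply: eq_bigr => e _; case: (e \in S).
rewrite bern_sum (eq_bigr (fun=> q)) ?sumr_const ?mulr_natr // => e _.
transitivity (bern q (fun S => \prod_e' (if e' == e then (e' \in S)%:R else 1))).
  by apply: eq_bern => S; rewrite -big_mkcond big_pred1_eq.
rewrite (bern_prod q (fun e' b => if e' == e then b%:R else 1)) (bigD1 e) //= eqxx.
rewrite mulr1 mulr0 addr0 big1 ?mulr1 // => e' /negbTE ->.
by rewrite !mulr1 addrC subrK.
Qed.

Lemma bern_setU a b f :
  bern a (fun S => bern b (fun T => f (S :|: T))) = bern (a + b - a * b) f.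
Proof.
have delta (A T : {set E}) : (A == T)%:R = \prod_e ((e \in A) == (e \in T))%:R :> R.
  case: eqP => [->|/eqP neq]; first by rewrite big1 // => e _; rewrite eqxx.
  have [e eN] : exists e, (e \in A) != (e \in T).
    apply/existsP; apply: contraNT neq; rewrite negb_exists => /forallP H.
    by apply/eqP/setP => e; apply/eqP; have := H e; rewrite negbK.
  by rewrite (bigD1 e) //= (negbTE eN) mul0r.
have sumU A : f A = \sum_T (A == T)%:R * f T.
  rewrite (bigD1 A) //= eqxx mul1r big1 ?addr0 // => T.
  by rewrite eq_sym => /negbTE ->; rewrite mul0r.
have -> : bern a (fun S => bern b (fun T => f (S :|: T))) =
    \sum_T bern a (fun S => bern b (fun S' => (S :|: S' == T)%:R)) * f T.
  under eq_bern => S.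
    under eq_bern => S' do rewrite sumU.
    by rewrite bern_sum; over.
  rewrite bern_sum; apply: eq_bigr => T _.
  rewrite mulrC -bernZ; apply: eq_bern => S.
  by rewrite -bernZ; apply: eq_bern => S'; rewrite mulrC.
apply: eq_bigr => T _; congr (_ * _).
under eq_bern => S.
  under eq_bern => S' do [rewrite delta; under eq_bigr => e _ do rewrite inE].
  rewrite (bern_prod b (fun e y => (((e \in S) || y) == (e \in T))%:R)); over.
rewrite (bern_prod a (fun e x => b * ((x || true) == (e \in T))%:R +
   (1 - b) * ((x || false) == (e \in T))%:R)).
apply: eq_bigr => e _ /=; case: (e \in T); rewrite /= ?eqxx; ring.
Qed.

End Bernoulli.

(** * Sums over words *)

Section Pathsum.
Variables (R : realFieldType) (E : finType).
Implicit Types (s : seq E) (adm : seq E -> pred E) (F G : seq E -> R).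

(** One notion serves both expansions: unrestricted words for powers of a norm, walks for traces.
    Words grow at the head, so [adm] sees the latest letter first. *)
Fixpoint pathsum l adm s F : R :=
  if l is l'.+1 then \sum_(e | adm s e) pathsum l' adm (e :: s) F else F s.

Lemma ler_pathsum l adm s F G :
  (forall s', F s' <= G s') -> pathsum l adm s F <= pathsum l adm s G.
Proof.
move=> FG; elim: l s => //= l IH s.
by apply: ler_sum => e _; apply: IH.
Qed.

Lemma bern_pathsum q l adm s (F : {set E} -> seq E -> R) :
  bern q (fun S => pathsum l adm s (F S)) =
  pathsum l adm s (fun s' => bern q (F^~ s')).
Proof.
elim: l s => //= l IH s; rewrite bern_sum.
by apply: eq_bigr => e _; apply: IH.
Qed.

Lemma pathsum_size l adm s (c : R) F :
  pathsum l adm s (fun s' => c ^+ size s' * F s') =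
  c ^+ (size s + l) * pathsum l adm s F.
Proof.
elim: l s => [|l IH] s /=; first by rewrite addn0.
by rewrite mulr_sumr; apply: eq_bigr => e _; rewrite IH /= addSnnS.
Qed.

(* A new edge costs its weight, hence at most [rho] after summation, while a
   repeated edge is one of at most [N] earlier ones. *)
Lemma pathsum_distinct_le (w : E -> R) (rho : R) (N : nat) l adm s :
  (forall e, 0 <= w e) -> 0 <= rho ->
  (forall s', \sum_(e | adm s' e) w e <= rho) ->
  (size s + l <= N)%N ->
  pathsum l adm s (fun s' => \prod_(e in s') w e) <=
  (rho + N%:R) ^+ l * \prod_(e in s) w e.
Proof.
move=> w0 rho0 wrho; elim: l s => [|l IH] s /= sN; first by rewrite expr0 mul1r.
have W0 (s' : seq E) : 0 <= \prod_(e in s') w e by apply: prodr_ge0.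
have stepE e : \prod_(e' in e :: s) w e' <=
    ((e \in s)%:R + w e) * \prod_(e' in s) w e'.
  rewrite mulrDl; have [es|es] := boolP (e \in s).
    rewrite mul1r (eq_bigl (mem s)) ?lerDl ?mulr_ge0 // => e' /=.
    by rewrite inE; case: eqP => // ->.
  rewrite mul0r add0r (bigD1 e) ?mem_head //=.
  rewrite (eq_bigl (mem s)) // => e' /=.
  by rewrite inE; case: eqP => [->|_]; rewrite ?(negbTE es) ?andbF ?andbT.
have C0 : 0 <= rho + N%:R by rewrite addr_ge0.
apply: le_trans (_ : \sum_(e | adm s e) (rho + N%:R) ^+ l *
    (((e \in s)%:R + w e) * \prod_(e' in s) w e') <= _).
  apply: ler_sum => e _; apply: le_trans (IH _ _) _; first by rewrite /= addSnnS.
  by rewrite ler_wpM2l ?exprn_ge0.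
rewrite -mulr_sumr -mulr_suml exprSr -mulrA ler_wpM2l ?exprn_ge0 //.
rewrite ler_wpM2r // big_split /= addrC lerD ?wrho //.
apply: le_trans (_ : \sum_e (e \in s)%:R <= _).
  by rewrite big_mkcond /=; apply: ler_sum => e _; case: ifP.
rewrite -natr_sum ler_nat -big_mkcond /= sum1_card.
by apply: leq_trans (card_size s) _; apply: leq_trans sN; rewrite leq_addr.
Qed.

End Pathsum.

(** * Mixed moments of centered indicators *)

Section Moments.
Variables (R : realFieldType) (E : finType).
Implicit Types (q : R) (S : {set E}) (s : seq E).

Definition dev q e S : R := (e \in S)%:R / q - 1.

Lemma prod_count (F : E -> R) s :
  \prod_(e <- s) F e = \prod_e F e ^+ count_mem e s.
Proof.
elim: s => [|a s IH] /=; first by rewrite big_nil big1.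
rewrite big_cons IH; under [RHS]eq_bigr => e _ do rewrite exprD.
rewrite big_split /=; congr (_ * _).
rewrite (bigD1 a) //= eqxx expr1 big1 ?mulr1 // => e.
by rewrite eq_sym => /negbTE ->; rewrite expr0.
Qed.

Lemma exprD1_ge (a : R) m : 0 <= a -> a ^+ m.+1 + 1 <= (a + 1) ^+ m.+1.
Proof.
move=> a0; elim: m => [|m IH]; first by rewrite !expr1.
rewrite exprS [leRHS]exprS.
apply: le_trans (_ : (a + 1) * (a ^+ m.+1 + 1) <= _).
  have := exprn_ge0 m.+1 a0; move: (a ^+ m.+1) => b b0; nra.
by rewrite ler_wpM2l // addr_ge0.
Qed.

(** With [a = q^-1 - 1] one has [q * a = 1 - q], so the left side is at most
    [(1 - q) * (a ^+ k.+1 + 1)], and powers are superadditive. The exponent is one less than the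
    order of the moment: this saves the factor [q] that a sup bound would lose. *)
Lemma dev_moment_le q (k : nat) : 0 < q <= 1 ->
  `|q * (q^-1 - 1) ^+ k.+2 + (1 - q) * (- 1) ^+ k.+2| <= q^-1 ^+ k.+1.
Proof.
move=> /andP[q0 q1]; have a0 : 0 <= q^-1 - 1 by rewrite subr_ge0 invf_ge1.
have q1' : 0 <= 1 - q by rewrite subr_ge0.
apply: le_trans (ler_normD _ _) _.
rewrite normrM normrX (ger0_norm a0) (gtr0_norm q0) [X in _ + X]normrM normrX normrN1 expr1n.
rewrite (ger0_norm q1') mulr1 exprS mulrA mulrBr mulr1 divff ?gt_eqF //.
rewrite -{2}(mulr1 (1 - q)) -mulrDr.
apply: le_trans (_ : 1 * (q^-1 - 1 + 1) ^+ k.+1 <= _).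
  apply: ler_pM => //; first by rewrite addr_ge0 ?exprn_ge0.
    by rewrite gerBl ltW.
  exact: exprD1_ge.
by rewrite mul1r subrK.
Qed.

Section Weighted.
Variables (q L : R) (z : E -> R).
Hypotheses (q01 : 0 < q <= 1) (L0 : 0 < L).
Hypothesis (z0 : forall e, 0 <= z e) (zL : forall e, z e <= q * L).

Let w e : R := z e ^+ 2 / (q * L ^+ 2).

(** The expectation factors over distinct letters. Multiplicity one gives zero; multiplicity
    [k >= 2] gives at most [(z e / q) ^+ (k - 2) * (z e ^+ 2 / q)], and [z e / q <= L] turns this
    into [L ^+ k * w e]. So a repeated letter pays its weight [w e] only once. *)
Lemma bern_prod_dev_le s :
  `|bern q (fun S => \prod_(e <- s) dev q e S)| * \prod_(e <- s) z e <=
  L ^+ size s * \prod_(e in s) w e.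
Proof.
have [q0 q1] := andP q01.
have -> : L ^+ size s = \prod_(e <- s) L.
  by rewrite big_const_seq count_predT -Monoid.iteropE.
rewrite !(prod_count _ s) [X in _ <= _ * X]big_mkcond /= -big_split /=.
under eq_bern => S do rewrite (prod_count _ s) /dev.
rewrite (bern_prod q (fun e b => (b%:R / q - 1) ^+ count_mem e s)).
rewrite normr_prod -big_split /=; apply: ler_prod => e _.
rewrite mulr_ge0 ?exprn_ge0 //= mul1r mul0r sub0r.
case: (boolP (e \in s)) => es; last first.
  rewrite (count_memPn es) !expr0 !mulr1 addrC subrK normr1.
  by rewrite lexx.
have : (0 < count_mem e s)%N by rewrite -has_count has_pred1.
case: (count_mem e s) => // -[_|k _].
  rewrite !expr1 mulrBr divff ?gt_eqF // mulr1 mulrN1 subrr normr0 mul0r.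
  by rewrite mulr_ge0 ?(ltW L0) // divr_ge0 ?exprn_ge0 // mulr_ge0 ?exprn_ge0 ?ltW.
apply: le_trans (_ : q^-1 ^+ k.+1 * z e ^+ k.+2 <= _).
  by rewrite ler_wpM2r ?exprn_ge0 //; apply: dev_moment_le.
have -> : L ^+ k.+2 * w e = L ^+ k * (z e ^+ 2 / q).
  rewrite /w !exprS; field.
  by rewrite gt_eqF //= gt_eqF.
have -> : q^-1 ^+ k.+1 * z e ^+ k.+2 = (z e / q) ^+ k * (z e ^+ 2 / q).
  rewrite expr_div_n !exprS exprVn; field.
  by rewrite expf_neq0 ?gt_eqF.
rewrite ler_wpM2r ?divr_ge0 ?exprn_ge0 ?(ltW q0) //.
rewrite lerXn2r ?nnegrE ?(ltW L0) ?divr_ge0 ?(ltW q0) //.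
by rewrite ler_pdivrMr // mulrC.
Qed.

(** The number [l] bounds both the total weight of a new letter and the number of earlier letters
    that can be repeated, so each letter costs [(l + l) * L]. *)
Lemma bern_pathsum_dev_le l adm (c : seq E -> R) :
  (forall s, `|c s| <= \prod_(e <- s) z e) ->
  (forall s, \sum_(e | adm s e) z e ^+ 2 <= l%:R * (q * L ^+ 2)) ->
  bern q (fun S => pathsum l adm [::]
                     (fun s => c s * \prod_(e <- s) dev q e S)) <=
  (l%:R *+ 2 * L) ^+ l.
Proof.
move=> cz zl; have [q0 q1] := andP q01.
rewrite bern_pathsum.
have qL0 : 0 < q * L ^+ 2 by rewrite mulr_gt0 ?exprn_gt0.
apply: le_trans (ler_pathsum _ _ _ (G := fun s => L ^+ size s * \prod_(e in s) w e) _) _.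
  move=> s; rewrite bernZ; apply: le_trans (bern_prod_dev_le s).
  apply: le_trans (ler_norm _) _.
  by rewrite normrM mulrC ler_wpM2l.
rewrite pathsum_size add0n exprMn mulrC ler_wpM2r ?exprn_ge0 ?(ltW L0) //.
apply: le_trans (pathsum_distinct_le (rho := l%:R) (N := l) _ _ _ _) _ => //.
- by move=> e; rewrite /w divr_ge0 ?exprn_ge0 ?(ltW qL0).
- by move=> s; rewrite -mulr_suml ler_pdivrMr.
- by rewrite big_pred0 ?mulr1 ?mulr2n.
Qed.

End Weighted.

End Moments.

(** * Norms and tail bounds *)

Section Inner.
Variable R : realType.

Definition sqn m n (M : 'M[R]_(m, n)) : R := inner M M.

Lemma innerE m n (M N : 'M[R]_(m, n)) :
  inner M N = \sum_i \sum_j M i j * N i j.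
Proof.
rewrite /inner /mxtrace exchange_big /=; apply: eq_bigr => j _.
by rewrite mxE; apply: eq_bigr => i _; rewrite mxE.
Qed.

Lemma innerC m n (M N : 'M[R]_(m, n)) : inner M N = inner N M.
Proof.
by rewrite !innerE; apply: eq_bigr => i _; apply: eq_bigr => j _; rewrite mulrC.
Qed.

Lemma innerDr m n (M N P : 'M[R]_(m, n)) :
  inner M (N + P) = inner M N + inner M P.
Proof. by rewrite /inner mulmxDr mxtraceD. Qed.

Lemma innerZr m n a (M N : 'M[R]_(m, n)) : inner M (a *: N) = a * inner M N.
Proof. by rewrite /inner -scalemxAr mxtraceZ. Qed.

Lemma inner0r m n (M : 'M[R]_(m, n)) : inner M 0 = 0.
Proof. by rewrite -(scale0r (0 : 'M[R]_(m, n))) innerZr mul0r. Qed.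

Lemma innerNr m n (M N : 'M[R]_(m, n)) : inner M (- N) = - inner M N.
Proof. by rewrite -scaleN1r innerZr mulN1r. Qed.

Lemma innerBr m n (M N P : 'M[R]_(m, n)) :
  inner M (N - P) = inner M N - inner M P.
Proof. by rewrite innerDr innerNr. Qed.

Lemma innerDl m n (M N P : 'M[R]_(m, n)) :
  inner (N + P) M = inner N M + inner P M.
Proof. by rewrite innerC innerDr !(innerC M). Qed.

Lemma innerZl m n a (M N : 'M[R]_(m, n)) : inner (a *: N) M = a * inner N M.
Proof. by rewrite innerC innerZr (innerC M). Qed.

Lemma innerNl m n (M N : 'M[R]_(m, n)) : inner (- N) M = - inner N M.
Proof. by rewrite innerC innerNr (innerC M). Qed.

Lemma innerBl m n (M N P : 'M[R]_(m, n)) :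
  inner (N - P) M = inner N M - inner P M.
Proof. by rewrite innerDl innerNl. Qed.

Lemma inner_sumr m n (I : Type) (r : seq I) (P : pred I) (M : 'M[R]_(m, n)) F :
  inner M (\sum_(i <- r | P i) F i) = \sum_(i <- r | P i) inner M (F i).
Proof.
by elim/big_ind2: _ => [|x1 x2 y1 y2 <- <-|//]; rewrite ?inner0r ?innerDr.
Qed.

Lemma inner_suml m n (I : Type) (r : seq I) (P : pred I) (M : 'M[R]_(m, n)) F :
  inner (\sum_(i <- r | P i) F i) M = \sum_(i <- r | P i) inner (F i) M.
Proof. by rewrite innerC inner_sumr; apply: eq_bigr => i _; rewrite innerC. Qed.

Lemma inner_mull m n p (A : 'M[R]_(m, n)) (B : 'M[R]_(n, p)) C :
  inner (A *m B) C = inner B (A^T *m C).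
Proof. by rewrite /inner trmx_mul mulmxA. Qed.

Lemma inner_tr m n (M N : 'M[R]_(m, n)) : inner M^T N^T = inner M N.
Proof. by rewrite /inner trmxK mxtrace_mulC -mxtrace_tr trmx_mul trmxK. Qed.

Lemma inner_mulr m n p (A : 'M[R]_(m, n)) (B : 'M[R]_(n, p)) C :
  inner (A *m B) C = inner A (C *m B^T).
Proof. by rewrite -inner_tr trmx_mul inner_mull -inner_tr trmx_mul !trmxK. Qed.

Lemma inner_delta m n (M : 'M[R]_(m, n)) i j : inner (delta_mx i j) M = M i j.
Proof.
rewrite innerE (bigD1 i) //= (bigD1 j) //= mxE !eqxx mul1r.
rewrite big1 => [|k /negbTE kj]; last by rewrite mxE kj andbF mul0r.
rewrite addr0 big1 ?addr0 // => k /negbTE ki.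
by rewrite big1 // => l _; rewrite mxE ki mul0r.
Qed.

Lemma sqnE m n (M : 'M[R]_(m, n)) : sqn M = \sum_i \sum_j M i j ^+ 2.
Proof.
by rewrite /sqn innerE; apply: eq_bigr => i _; apply: eq_bigr => j _.
Qed.

Lemma sqn_ge0 m n (M : 'M[R]_(m, n)) : 0 <= sqn M.
Proof. by rewrite sqnE !sumr_ge0 // => i _; rewrite sumr_ge0 // => j _; rewrite sqr_ge0. Qed.

Lemma sqn_eq0 m n (M : 'M[R]_(m, n)) : sqn M = 0 -> M = 0.
Proof.
rewrite sqnE => /eqP; rewrite psumr_eq0 => [/allP H|i _]; last first.
  by rewrite sumr_ge0 // => j _; rewrite sqr_ge0.
apply/matrixP => i j; have := H i (mem_index_enum i).
rewrite psumr_eq0 => [/allP /(_ j (mem_index_enum j))|k _]; last exact: sqr_ge0.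
by rewrite sqrf_eq0 mxE => /eqP.
Qed.

Lemma sqn0 m n : sqn (0 : 'M[R]_(m, n)) = 0.
Proof. exact: inner0r. Qed.

Lemma sqnZ m n a (M : 'M[R]_(m, n)) : sqn (a *: M) = a ^+ 2 * sqn M.
Proof. by rewrite /sqn innerZl innerZr mulrA. Qed.

Lemma sqn_tr m n (M : 'M[R]_(m, n)) : sqn M^T = sqn M.
Proof. exact: inner_tr. Qed.

Lemma sqnD m n (M N : 'M[R]_(m, n)) :
  sqn (M + N) = sqn M + 2 * inner M N + sqn N.
Proof. by rewrite /sqn innerDl !innerDr (innerC N M); ring. Qed.

Lemma sqnB m n (M N : 'M[R]_(m, n)) :
  sqn (M - N) = sqn M - 2 * inner M N + sqn N.
Proof. by rewrite /sqn innerBl !innerBr (innerC N M); ring. Qed.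

Lemma fnorm_sqn m n (M : 'M[R]_(m, n)) : fnorm M ^+ 2 = sqn M.
Proof. by rewrite /fnorm sqr_sqrtr -?sqnE ?sqn_ge0. Qed.

Lemma inner_le m n (M N : 'M[R]_(m, n)) :
  inner M N <= 2^-1 * (sqn M + sqn N).
Proof. by have := sqn_ge0 (M - N); rewrite sqnB; lra. Qed.

Lemma inner_CS m n (M N : 'M[R]_(m, n)) :
  inner M N ^+ 2 <= sqn M * sqn N.
Proof.
have [/sqn_eq0 ->|/eqP M0] := eqVneq (sqn M) 0.
  by rewrite sqn0 innerC inner0r expr0n mul0r.
have Mp : 0 < sqn M by rewrite lt_def sqn_ge0 andbT; apply/eqP.
have := sqn_ge0 (sqn M *: N - inner M N *: M).
rewrite sqnB !sqnZ innerZl innerZr (innerC N).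
move: (sqn M) (sqn N) (inner M N) Mp => a b c a0 H.
have : 0 <= a * (a * b - c ^+ 2) by nra.
by rewrite pmulr_rge0 // subr_ge0.
Qed.

Lemma inner_abs_le m n (M N : 'M[R]_(m, n)) a b : 0 <= a -> 0 <= b ->
  sqn M <= a ^+ 2 -> sqn N <= b ^+ 2 -> `|inner M N| <= a * b.
Proof.
move=> a0 b0 Ma Nb; rewrite -ler_sqr ?nnegrE ?mulr_ge0 // real_normK ?num_real //.
by rewrite exprMn; apply: le_trans (inner_CS M N) _; rewrite ler_pM ?sqn_ge0.
Qed.

Lemma sqn_row m n (M : 'M[R]_(m, n)) i : sqn (row i M) = \sum_j M i j ^+ 2.
Proof. by rewrite sqnE big_ord1; apply: eq_bigr => j _; rewrite mxE. Qed.

Lemma sqn_col m n (M : 'M[R]_(m, n)) j : sqn (col j M) = \sum_i M i j ^+ 2.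
Proof. by rewrite sqnE; apply: eq_bigr => i _; rewrite big_ord1 mxE. Qed.

Lemma sqn_mulmx_le m n p (A : 'M[R]_(m, n)) (B : 'M[R]_(n, p)) :
  sqn (A *m B) <= sqn A * sqn B.
Proof.
rewrite !sqnE mulr_suml; apply: ler_sum => i _.
rewrite [X in _ * X]exchange_big mulr_sumr /=.
apply: ler_sum => j _; rewrite mxE.
have := inner_CS (row i A) (col j B)^T.
rewrite innerE big_ord1 (eq_bigr (fun k => A i k * B k j)) => [|k _]; last by rewrite !mxE.
by rewrite sqn_tr sqn_row sqn_col.
Qed.

Definition op_le m n (M : 'M[R]_(m, n)) (t : R) :=
  forall y : 'cV[R]_n, sqn (M *m y) <= t ^+ 2 * sqn y.

(** Cauchy-Schwarz for [sqn (M *m y)], read as the inner product of [y] and [M^T *m (M *m y)]; one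
    factor [sqn (M *m y)] then cancels. *)
Lemma op_le_tr m n (M : 'M[R]_(m, n)) t : op_le M^T t -> op_le M t.
Proof.
move=> H y; have := inner_CS y (M^T *m (M *m y)).
have -> : inner y (M^T *m (M *m y)) = sqn (M *m y).
  by rewrite innerC inner_mull trmxK.
have := H (M *m y); move: (sqn_ge0 (M *m y)) (sqn_ge0 y).
move: (sqn (M *m y)) (sqn y) (sqn (M^T *m _)) => a b c a0 b0 ca CS.
have [->|an0] := eqVneq a 0; first by rewrite mulr_ge0 ?sqr_ge0.
have ap : 0 < a by rewrite lt_def an0.
rewrite -(ler_pM2l ap) -expr2; apply: le_trans CS _.
have -> : a * (t ^+ 2 * b) = b * (t ^+ 2 * a) by ring.
by rewrite ler_wpM2l.
Qed.

End Inner.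

(** * Tail bounds by the moment method *)

Section Tails.
Variables (R : realType).

Section VectorTail.
Variables (E : finType) (n1 n2 : nat) (v : E -> 'M[R]_(n1, n2)) (z : E -> R).
Hypothesis z0 : forall e, 0 <= z e.
Hypothesis vz : forall e, sqn (v e) <= z e ^+ 2.

(** Coefficient of a word in the expansion of a power of [sqn (\sum_e x e *: v e)], two letters per
    factor. The value 0 on odd words keeps [pair_inner_le] true for every word. *)
Fixpoint pair_inner (s : seq E) : R :=
  if s is e' :: s1 then
    if s1 is e :: s2 then inner (v e) (v e') * pair_inner s2 else 0
  else 1.

Lemma pair_inner_le s : `|pair_inner s| <= \prod_(e <- s) z e.
Proof.
have [k] := ubnP (size s); elim: k s => // k IH [|e' [|e s]] /= sk.
- by rewrite normr1 big_nil.
- by rewrite normr0 prodr_ge0.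
rewrite normrM !big_cons mulrA ler_pM // ?(mulrC (z e')) ?inner_abs_le //.
by apply: IH; rewrite ltnS in sk; apply: leq_ltn_trans sk.
Qed.

Lemma pathsum_pair_inner (x : E -> R) p s :
  pathsum p.*2 (fun _ => predT) s (fun s' => pair_inner s' * \prod_(e <- s') x e) =
  sqn (\sum_e x e *: v e) ^+ p * (pair_inner s * \prod_(e <- s) x e).
Proof.
elim: p s => [|p IH] s /=; first by rewrite expr0 mul1r.
under eq_bigr => e _ do under eq_bigr => e' _ do rewrite IH /= !big_cons.
rewrite exprSr -[RHS]mulrA [X in _ = _ * (X * _)]/sqn inner_suml mulr_suml mulr_sumr.
apply: eq_bigr => e _; rewrite inner_sumr mulr_suml mulr_sumr.
by apply: eq_bigr => e' _; rewrite innerZl innerZr; ring.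
Qed.

(** Markov's inequality for the moment of order [p.*2]. The last two hypotheses are the two regimes
    of Bernstein's inequality, largest term and variance; [L] is chosen so that the moment bound
    becomes exactly [(t / K) ^+ p.*2]. *)
Lemma vector_tail (q t K : R) (p : nat) : 0 < q <= 1 -> 0 < t -> 0 < K -> (0 < p)%N ->
  (forall e, z e * (2 * K * p.*2%:R) <= q * t) ->
  (\sum_e z e ^+ 2) * ((2 * K) ^+ 2 * p.*2%:R) <= q * t ^+ 2 ->
  bern q (fun S => (t ^+ 2 < sqn (\sum_e dev q e S *: v e))%R%:R) <= K^-1 ^+ p.*2.
Proof.
move=> q01 t0 K0 p0 zt zzt; have [q0 q1] := andP q01.
have l0 : 0 < p.*2%:R :> R by rewrite ltr0n double_gt0.
have c0 : 0 < 2 * K * p.*2%:R by rewrite !mulr_gt0.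
pose L := t / (2 * K * p.*2%:R).
have L0 : 0 < L by rewrite divr_gt0.
have zL e : z e <= q * L by rewrite mulrA ler_pdivlMr //; apply: zt.
have q01' : 0 <= q <= 1 by rewrite ltW.
apply: le_trans (bern_markov q01' (exprn_gt0 p.*2 t0) (f := fun S =>
  sqn (\sum_e dev q e S *: v e) ^+ p) _ _) _.
- by move=> S; rewrite exprn_ge0 ?sqn_ge0.
- move=> S /ltW tS; rewrite -mul2n exprM lerXn2r ?nnegrE ?sqn_ge0 //.
  by rewrite exprn_ge0 ?ltW.
rewrite ler_pdivrMr ?exprn_gt0 //.
have := bern_pathsum_dev_le (l := p.*2) (adm := fun _ => predT) q01 L0 z0 zL pair_inner_le.
under eq_bern => S do rewrite (pathsum_pair_inner (fun e => dev q e S)) /= big_nil !mulr1.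
move=> H; apply: le_trans (H _) _ => [_|].
  rewrite (_ : \sum_(e | _) _ = \sum_e z e ^+ 2) //.
  have -> : p.*2%:R * (q * L ^+ 2) = q * t ^+ 2 / ((2 * K) ^+ 2 * p.*2%:R).
    by rewrite /L; field; rewrite !gt_eqF.
  by rewrite ler_pdivlMr // mulr_gt0 // exprn_gt0 // mulr_gt0.
rewrite -exprMn (_ : _ * L = K^-1 * t) // /L -mulr_natr; field.
by rewrite !gt_eqF.
Qed.

End VectorTail.

Lemma trmx_exp n (A : 'M[R]_n) k : (A ^+ k)^T = A^T ^+ k.
Proof.
elim: k => [|k IH]; first by rewrite !expr0 trmx1.
by rewrite exprSr exprS -!mulmxE trmx_mul IH.
Qed.

Lemma gram_sym m n (D : 'M[R]_(m, n)) : (D *m D^T)^T = D *m D^T.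
Proof. by rewrite trmx_mul trmxK. Qed.

Lemma trace_gram_exp_ge0 m n (D : 'M[R]_(m, n)) p : 0 <= \tr ((D *m D^T) ^+ p).
Proof.
rewrite -(odd_double_half p) -addnn addnA !exprD.
set B := (D *m D^T) ^+ p./2.
have BT : B^T = B by rewrite trmx_exp gram_sym.
have -> : (D *m D^T) ^+ odd p * B * B = B *m (D *m D^T) ^+ odd p *m B^T.
  by rewrite BT !mulmxE -exprD addnC exprD.
case: odd; rewrite ?expr1 ?expr0.
  have -> : B *m (D *m D^T) *m B^T = (B *m D) *m (B *m D)^T by rewrite trmx_mul !mulmxA.
  by rewrite mxtrace_mulC; exact: sqn_ge0.
by rewrite mulmx1 mxtrace_mulC; exact: sqn_ge0.
Qed.

(* Squaring [x^T A x] by Cauchy-Schwarz [j] times gives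
   [(x^T A x)^(2^j) <= |x|^(2^(j+1)) tr (A^(2^j))] without diagonalizing [A]. *)
Lemma trace_op_le m n (D : 'M[R]_(m, n)) (t : R) j : 0 <= t ->
  \tr ((D *m D^T) ^+ (2 ^ j)) <= t ^+ (2 ^ j).*2 -> op_le D t.
Proof.
move=> t0; set A := D *m D^T => trA; apply: op_le_tr => x.
have AT k : (A ^+ k)^T = A ^+ k by rewrite trmx_exp gram_sym.
have pow i : inner x (A *m x) ^+ (2 ^ i) * sqn x <=
    sqn x ^+ (2 ^ i) * inner x (A ^+ (2 ^ i) *m x).
  elim: i => [|i IH]; first by rewrite expn0 !expr1 mulrC.
  have [x0|x0] := eqVneq (sqn x) 0.
    by rewrite (sqn_eq0 x0) sqn0 mulr0 expr0n expn_eq0 mul0r.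
  have xp : 0 < sqn x by rewrite lt_def x0 sqn_ge0.
  have xx0 : 0 <= inner x (A *m x).
    by rewrite -mulmxA innerC inner_mull; exact: sqn_ge0.
  have := inner_CS x (A ^+ (2 ^ i) *m x).
  rewrite {2}/sqn (inner_mull (A ^+ _)) AT mulmxA mulmxE -exprD addnn -mul2n -expnS => CS.
  rewrite -(ler_pM2r xp); apply: le_trans (_ : (inner x (A *m x) ^+ (2 ^ i) * sqn x) ^+ 2 <= _).
    by rewrite exprMn -exprM mulnC -expnS expr2 mulrA.
  apply: le_trans (_ : (sqn x ^+ (2 ^ i) * inner x (A ^+ (2 ^ i) *m x)) ^+ 2 <= _).
    rewrite lerXn2r ?nnegrE //; first by rewrite mulr_ge0 ?exprn_ge0 ?sqn_ge0.
    by apply: le_trans IH; rewrite mulr_ge0 ?exprn_ge0 ?sqn_ge0.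
  rewrite exprMn -exprM mulnC -expnS -mulrA ler_wpM2l ?exprn_ge0 ?sqn_ge0 //.
  by rewrite mulrC.
(* An even power of [A] is the square of a symmetric matrix [C], and [sqn (C *m x) <= sqn C * sqn x]
   with [sqn C] the trace. For [j = 0] the factor [D^T] plays the part of [C]. *)
have last : inner x (A ^+ (2 ^ j) *m x) <= sqn x * \tr (A ^+ (2 ^ j)).
  case: j {trA} => [|j].
    rewrite expn0 !expr1 -mulmxA innerC inner_mull mxtrace_mulC.
    by rewrite mulrC -[\tr _](sqn_tr D); exact: sqn_mulmx_le.
  rewrite expnS mul2n -addnn exprD -mulmxE -mulmxA innerC inner_mull AT.
  rewrite mulrC -[X in \tr (X *m _)]AT; exact: sqn_mulmx_le.
have [x0|x0] := eqVneq (sqn x) 0.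
  by rewrite (sqn_eq0 x0) mulmx0 !sqn0 mulr0.
have xp : 0 < sqn x by rewrite lt_def x0 sqn_ge0.
have p0 : (0 < 2 ^ j)%N by rewrite expn_gt0.
have <- : inner x (A *m x) = sqn (D^T *m x) by rewrite /sqn inner_mull trmxK mulmxA.
rewrite -(ler_pXn2r p0) ?nnegrE ?mulr_ge0 ?sqr_ge0 ?(ltW xp) //; last first.
  by rewrite -mulmxA innerC inner_mull; exact: sqn_ge0.
rewrite -(ler_pM2r xp); apply: le_trans (pow j) _.
rewrite exprMn -exprM mul2n -[leRHS]mulrA [leRHS]mulrCA ler_wpM2l ?exprn_ge0 ?sqn_ge0 //.
apply: le_trans last _; rewrite mulrC ler_wpM2r ?sqn_ge0 //.
Qed.

Section MatrixTail.
Variables (n1 n2 : nat) (Z : 'M[R]_(n1, n2)).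
Let E : finType := ('I_n1 * 'I_n2)%type.

Definition cur_row (i : 'I_n1) (s : seq E) := if s is e :: _ then e.1 else i.

(* Words in the entries (latest first) tracing a walk from row [i] in the
   bipartite graph of rows and columns. *)
Definition walk (i : 'I_n1) (s : seq E) : pred E := fun e =>
  if odd (size s) then (if s is e' :: _ then e.2 == e'.2 else false)
  else e.1 == cur_row i s.

Lemma sum_fst (F : E -> R) i : \sum_(e : E | e.1 == i) F e = \sum_j F (i, j).
Proof.
transitivity (\sum_(e : E | (e.1 == i) && true) F (e.1, e.2)).
  by apply: eq_big => [e|[? ?] //]; rewrite andbT.
by rewrite -(pair_big (pred1 i) xpredT (fun i j => F (i, j))) big_pred1_eq.
Qed.

Lemma sum_snd (F : E -> R) j : \sum_(e : E | e.2 == j) F e = \sum_i F (i, j).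
Proof.
transitivity (\sum_(e : E | true && (e.2 == j)) F (e.1, e.2)).
  by apply: eq_big => [e|[? ?] //].
rewrite -(pair_big xpredT (pred1 j) (fun i j => F (i, j))) /=.
by apply: eq_bigr => i _; rewrite big_pred1_eq.
Qed.

Lemma pathsum_walk (D : 'M[R]_(n1, n2)) i i' p s : ~~ odd (size s) ->
  pathsum p.*2 (walk i) s
    (fun s' => (cur_row i s' == i')%:R * \prod_(e <- s') D e.1 e.2) =
  ((D *m D^T) ^+ p) (cur_row i s) i' * \prod_(e <- s) D e.1 e.2.
Proof.
elim: p s => [|p IH] s os /=; first by rewrite expr0 mxE.
rewrite (eq_bigl (fun e : E => e.1 == cur_row i s)) => [|e]; last first.
  by rewrite /walk (negbTE os).
rewrite sum_fst; set F := fun _ => _ * _.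
have step j : \sum_(e | walk i ((cur_row i s, j) :: s) e)
      pathsum p.*2 (walk i) [:: e, (cur_row i s, j) & s] F =
    \sum_k pathsum p.*2 (walk i) [:: (k, j), (cur_row i s, j) & s] F.
  rewrite -(sum_snd (fun e => pathsum p.*2 (walk i) [:: e, (cur_row i s, j) & s] F)).
  by apply: eq_bigl => e; rewrite /walk /= os.
rewrite (eq_bigr _ (fun j _ => step j)) exchange_big /= exprS -mulmxE mxE mulr_suml.
apply: eq_bigr => k _; rewrite mxE mulr_suml mulr_suml.
apply: eq_bigr => j _; rewrite IH ?negbK //= !big_cons mxE /=; ring.
Qed.

(** The condition that a walk closes is put into its coefficient. Since the next letter is confined
    to one row or one column, the variance is a single line sum instead of the full Frobenius norm
    that [vector_tail] would require. The factor [n1] counts the starting rows. *)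
Lemma matrix_tail (q t K : R) (p : nat) : 0 < q <= 1 -> 0 < t -> 0 < K -> (0 < p)%N ->
  (forall i j, `|Z i j| * (2 * K * p.*2%:R) <= q * t) ->
  (forall i, (\sum_j Z i j ^+ 2) * ((2 * K) ^+ 2 * p.*2%:R) <= q * t ^+ 2) ->
  (forall j, (\sum_i Z i j ^+ 2) * ((2 * K) ^+ 2 * p.*2%:R) <= q * t ^+ 2) ->
  bern q (fun S : {set E} =>
    let D := \matrix_(i, j) (dev q (i, j) S * Z i j) in
    (t ^+ p.*2 < \tr ((D *m D^T) ^+ p))%R%:R) <= n1%:R * K^-1 ^+ p.*2.
Proof.
move=> q01 t0 K0 p0 zt rowt colt; have [q0 q1] := andP q01.
have l0 : 0 < p.*2%:R :> R by rewrite ltr0n double_gt0.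
have c0 : 0 < 2 * K * p.*2%:R by rewrite !mulr_gt0.
have c2 : 0 < (2 * K) ^+ 2 * p.*2%:R by rewrite mulr_gt0 ?exprn_gt0 ?mulr_gt0.
pose L := t / (2 * K * p.*2%:R).
have L0 : 0 < L by rewrite divr_gt0.
pose z (e : E) := `|Z e.1 e.2|.
have z0 e : 0 <= z e by exact: normr_ge0.
have zL e : z e <= q * L by rewrite mulrA ler_pdivlMr //; apply: zt.
have q01' : 0 <= q <= 1 by rewrite ltW.
pose D S := \matrix_(i, j) (dev q (i, j) S * Z i j).
have LE : p.*2%:R * (q * L ^+ 2) = q * t ^+ 2 / ((2 * K) ^+ 2 * p.*2%:R).
  by rewrite /L; field; rewrite !gt_eqF.
have diag i : bern q (fun S => ((D S *m (D S)^T) ^+ p) i i) <= (p.*2%:R *+ 2 * L) ^+ p.*2.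
  have cz s : `|(cur_row i s == i)%:R * \prod_(e <- s) Z e.1 e.2| <= \prod_(e <- s) z e.
    rewrite normrM normr_prod -[leRHS]mul1r ler_wpM2r ?prodr_ge0 //.
    by case: eqP; rewrite ?normr1 ?normr0.
  have := bern_pathsum_dev_le (l := p.*2) (adm := walk i) q01 L0 z0 zL cz.
  set G := (X in bern q X); have -> : G = fun S => ((D S *m (D S)^T) ^+ p) i i.
    apply/funext => S; rewrite /G.
    have := pathsum_walk (D S) i i p (s := [::]) isT.
    rewrite big_nil mulr1 /= => <-; congr pathsum; apply/funext => s.
    rewrite -mulrA -big_split /=; congr (_ * _); apply: eq_bigr => -[a b] _.
    by rewrite mxE mulrC.
  apply => s; rewrite LE ler_pdivlMr // /walk.
  under eq_bigr => e _ do rewrite real_normK ?num_real //.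
  case: odd; last by rewrite sum_fst; apply: rowt.
  by case: s => [|e s]; [rewrite big_pred0 ?mul0r ?mulr_ge0 ?exprn_ge0 ?(ltW q0) ?(ltW t0) | rewrite sum_snd; apply: colt].
have mp S : 0 <= \tr ((D S *m (D S)^T) ^+ p).
  exact: trace_gram_exp_ge0.
apply: le_trans (bern_markov q01' (exprn_gt0 p.*2 t0) (f := fun S =>
  \tr ((D S *m (D S)^T) ^+ p)) _ _) _ => //; first by move=> S /ltW.
rewrite ler_pdivrMr ?exprn_gt0 // bern_sum.
apply: le_trans (ler_sum _ (fun i _ => diag i)) _.
rewrite sumr_const card_ord -[leLHS]mulr_natl -mulrA -exprMn.
rewrite (_ : _ * L = K^-1 * t) // /L -mulr_natr; field.
by rewrite !gt_eqF.
Qed.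

End MatrixTail.
End Tails.

(** * Singular values *)

Section Spectral.
Variable R : realType.

(** Take a complex eigenvector with real and imaginary parts [a] and [b]. Comparing
    [inner (a *m A) b] with [inner a (b *m A)] gives [Im l * (sqn a + sqn b) = 0], so the eigenvalue
    is real and whichever of [a], [b] is nonzero is an eigenvector. *)
Lemma sym_real_eigenvector n (A : 'M[R]_n.+1) : A^T = A ->
  exists a (v : 'rV[R]_n.+1), v != 0 /\ v *m A = a *: v.
Proof.
move=> AT; pose C : numClosedFieldType := R[i].
pose Ac : 'M[C]_n.+1 := map_mx (real_complex R) A.
have [l /eigenvalueP[v vA v0]] := @eigenvalue_closed C n.+1 Ac isT.
pose a : 'rV[R]_n.+1 := \row_j complex.Re (v 0 j).
pose b : 'rV[R]_n.+1 := \row_j complex.Im (v 0 j).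
have ReM (x : C) (y : R) : complex.Re (x * real_complex R y) = complex.Re x * y.
  by case: x => x1 x2 /=; rewrite mulr0 subr0.
have ImM (x : C) (y : R) : complex.Im (x * real_complex R y) = complex.Im x * y.
  by case: x => x1 x2 /=; rewrite mulr0 add0r.
have ReD (x y : C) : complex.Re (x + y) = complex.Re x + complex.Re y.
  by case: x; case: y.
have ImD (x y : C) : complex.Im (x + y) = complex.Im x + complex.Im y.
  by case: x; case: y.
have aA : a *m A = complex.Re l *: a - complex.Im l *: b.
  apply/rowP => k; have := congr1 (fun w : 'rV[C]_n.+1 => complex.Re (w 0 k)) vA.
  rewrite !mxE (big_morph (@complex.Re R) (id1 := 0) (op1 := +%R)) //.
  under eq_bigr => j _ do rewrite mxE ReM.
  under [in X in _ -> X = _]eq_bigr => j _ do rewrite mxE.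
  by move=> ->; case: l {vA} => ? ?; case: (v 0 k).
have bA : b *m A = complex.Re l *: b + complex.Im l *: a.
  apply/rowP => k; have := congr1 (fun w : 'rV[C]_n.+1 => complex.Im (w 0 k)) vA.
  rewrite !mxE (big_morph (@complex.Im R) (id1 := 0) (op1 := +%R)) //.
  under eq_bigr => j _ do rewrite mxE ImM.
  under [in X in _ -> X = _]eq_bigr => j _ do rewrite mxE.
  by move=> ->; case: l {vA aA} => ? ?; case: (v 0 k).
have ab0 : 0 < sqn a + sqn b.
  rewrite lt_def addr_ge0 ?sqn_ge0 // andbT; apply: contraNneq v0 => ab0.
  have [a0 b0] : sqn a = 0 /\ sqn b = 0.
    by have := sqn_ge0 a; have := sqn_ge0 b; move: ab0; split; lra.
  apply/eqP/rowP => k; rewrite mxE.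
  have := congr1 (fun w : 'rV_n.+1 => w 0 k) (sqn_eq0 a0).
  have := congr1 (fun w : 'rV_n.+1 => w 0 k) (sqn_eq0 b0).
  by rewrite !mxE; case: (v 0 k) => ? ? /= -> ->.
have l0 : complex.Im l = 0.
  have : inner (a *m A) b = inner a (b *m A) by rewrite inner_mulr AT.
  rewrite aA bA innerBl innerDr !innerZl !innerZr => H.
  have : complex.Im l * (sqn a + sqn b) = 0 by rewrite /sqn; lra.
  by move/eqP; rewrite mulf_eq0 (gt_eqF ab0) orbF => /eqP.
have [a0|a0] := eqVneq a 0.
  exists (complex.Re l), b; split; last by rewrite bA l0 scale0r addr0.
  by apply: contraTneq ab0 => ->; rewrite a0 !sqn0 addr0 ltxx.
by exists (complex.Re l), a; rewrite aA l0 scale0r subr0.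
Qed.

Lemma mul_rV_tr n (x y : 'rV[R]_n) : x *m y^T = (inner x y)%:M.
Proof.
by rewrite [LHS]mx11_scalar -inner_tr /inner trmxK /mxtrace big_ord1.
Qed.

(** The reflection that exchanges the first basis vector and [v], that is along their difference.
    Conjugating by it makes a given eigenvector the first basis vector, which splits off a
    one-by-one block in [spectral_sym]. *)
Lemma householder n (v : 'rV[R]_n.+1) : sqn v = 1 ->
  exists H : 'M[R]_n.+1, [/\ H^T = H, H *m H = 1%:M & delta_mx 0 0 *m H = v].
Proof.
move=> v1; pose e : 'rV[R]_n.+1 := delta_mx 0 0.
have e1 : sqn e = 1 by rewrite /sqn inner_delta mxE !eqxx.
have [ve|ve] := eqVneq (e - v) 0.
  exists 1%:M; rewrite trmx1 !mulmx1; split => //.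
  by apply/eqP; rewrite -subr_eq0 ve.
have [w wE] : exists w, w = e - v by exists (e - v).
rewrite -wE in ve; pose a := sqn w.
have a0 : a != 0 by apply: contraNneq ve => /sqn_eq0 ->.
have ww : w *m w^T = a%:M by exact: mul_rV_tr.
exists (1%:M - (2 / a) *: (w^T *m w)); split.
- by rewrite linearB linearZ /= trmx1 trmx_mul trmxK.
- have sq : w^T *m w *m (w^T *m w) = a *: (w^T *m w).
    by rewrite mulmxA -(mulmxA w^T w) ww mul_mx_scalar -scalemxAl.
  rewrite mulmxBl mul1mx mulmxBr mulmx1 -scalemxAl -scalemxAr sq !scalerA.
  rewrite (_ : 2 / a * (2 / a) * a = 2 / a + 2 / a); last by field.
  by rewrite scalerDl opprB addrK subrK.
- rewrite mulmxBr mulmx1 -scalemxAr mulmxA.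
  have -> : delta_mx 0 0 *m w^T = (a / 2)%:M.
    rewrite (mul_rV_tr e); congr _%:M.
    by rewrite /a wE sqnB innerBr -/(sqn e) e1 v1; field.
  rewrite mul_scalar_mx scalerA (_ : 2 / a * (a / 2) = 1) ?scale1r.
    by rewrite wE opprB addrC subrK.
  by field.
Qed.

Lemma spectral_sym n (A : 'M[R]_n) : A^T = A ->
  exists (P : 'M[R]_n) (d : 'rV[R]_n),
    P^T *m P = 1%:M /\ A = P^T *m diag_mx d *m P.
Proof.
elim: n A => [|n IH] A AT.
  by exists 1%:M, 0; split; apply/matrixP => -[].
have [a [v0 [v0n v0A]]] := sym_real_eigenvector AT.
have sv0 : 0 < sqn v0.
  by rewrite lt_def sqn_ge0 andbT; apply: contraNneq v0n => /sqn_eq0 ->.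
pose v := (Num.sqrt (sqn v0))^-1 *: v0.
have v1 : sqn v = 1.
  by rewrite sqnZ exprVn sqr_sqrtr ?ltW // mulVf ?gt_eqF.
have vA : v *m A = a *: v by rewrite -scalemxAl v0A !scalerA mulrC.
have [H [HT HH eH]] := householder v1.
have [B BE] : exists B : 'M[R]_(1 + n), B = H *m A *m H by exists (H *m A *m H).
have BT : B^T = B by rewrite BE !trmx_mul HT AT mulmxA.
have eB : delta_mx 0 0 *m B = a *: (delta_mx 0 0 : 'rV_n.+1).
  by rewrite BE !mulmxA eH vA -scalemxAl -eH -mulmxA HH mulmx1.
have B0 (j : 'I_(1 + n)) : B 0 j = a * (j == 0)%:R.
  have := congr1 (fun w : 'rV_n.+1 => w 0 j) eB.
  by rewrite -rowE !mxE /= => ->.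
have Bblock : B = block_mx a%:M 0 0 (drsubmx B).
  have ur : ursubmx B = 0.
    apply/matrixP => i j; rewrite !mxE (ord1 i) (_ : lshift n 0 = 0) ?B0; last exact/val_inj.
    by rewrite (_ : rshift 1 j == 0 = false) ?mulr0.
  rewrite -{1}[B]submxK ur (_ : dlsubmx B = 0); last first.
    by rewrite -[dlsubmx B]trmxK trmx_dlsub BT ur trmx0.
  congr block_mx; rewrite [LHS]mx11_scalar; congr _%:M; rewrite !mxE.
  by rewrite (_ : lshift n 0 = 0) ?B0 ?eqxx ?mulr1 //; exact/val_inj.
have [P [d [PP Bd]]] : exists (P : 'M[R]_n) (d : 'rV[R]_n),
    P^T *m P = 1%:M /\ drsubmx B = P^T *m diag_mx d *m P.
  by apply: IH; rewrite trmx_drsub BT.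
pose Q : 'M[R]_(1 + n) := block_mx 1%:M 0 0 P.
have QT : Q^T = block_mx 1%:M 0 0 P^T by rewrite tr_block_mx !trmx0 trmx1.
have QQ : Q^T *m Q = 1%:M.
  rewrite QT /Q mulmx_block !mul0mx !mulmx0 mul1mx PP.
  by rewrite !addr0 add0r -scalar_mx_block.
have QB : Q^T *m diag_mx (row_mx a%:M d) *m Q = B.
  rewrite QT diag_mx_row /Q !mulmx_block !mul0mx !mulmx0 !mul1mx !mulmx1.
  rewrite ?addr0 ?add0r ?mul0mx ?mulmx0 ?addr0 ?add0r -Bd [RHS]Bblock.
  congr block_mx; apply/matrixP => i j; by rewrite !mxE !ord1 !eqxx.
exists (Q *m H), (row_mx a%:M d); split.
  by rewrite trmx_mul HT mulmxA -(mulmxA H) QQ mulmx1.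
rewrite trmx_mul HT -!mulmxA (mulmxA Q^T) (mulmxA _ Q H) QB.
by rewrite BE !mulmxA HH mul1mx -mulmxA HH mulmx1.
Qed.

Lemma char_poly_orthosim n (A O : 'M[R]_n) : O^T *m O = 1%:M ->
  char_poly (O^T *m A *m O) = char_poly A.
Proof.
move=> OO; rewrite /char_poly /char_poly_mx.
have OO' : map_mx polyC O^T *m map_mx polyC O = 1%:M by rewrite -map_mxM OO map_mx1.
have -> : 'X%:M - map_mx polyC (O^T *m A *m O) =
    map_mx polyC O^T *m ('X%:M - map_mx polyC A) *m map_mx polyC O.
  rewrite !map_mxM mulmxBr mulmxBl; congr (_ - _).
  by rewrite mul_mx_scalar -scalemxAl OO' scalemx1.
by rewrite !det_mulmx mulrAC -det_mulmx OO' det1 mul1r.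
Qed.

End Spectral.

(** * Variational description of singular values *)

Section Sigma.
Variable R : realType.

Lemma eigenvalues_diag n (P : 'M[R]_n) (d : 'rV[R]_n) : P^T *m P = 1%:M ->
  perm_eq (eigenvalues (P^T *m diag_mx d *m P)) [seq d 0 i | i <- enum 'I_n].
Proof.
move=> PP; have cp : char_poly (P^T *m diag_mx d *m P) =
    \prod_(y <- [seq d 0 i | i <- enum 'I_n]) ('X - y%:P).
  rewrite char_poly_orthosim // char_poly_trig ?diag_mx_is_trig //.
  rewrite big_map big_enum; apply: eq_bigr => i _.
  by rewrite mxE eqxx mulr1n.
by apply/allP => x _ /=; rewrite count_eigenvalues cp mu_prod_XsubC.
Qed.

Lemma size_singular_values m n (X : 'M[R]_(m, n)) :
  size (singular_values X) = n.
Proof.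
have [|P [d [PP XX]]] := @spectral_sym R n (X^T *m X).
  by rewrite trmx_mul trmxK.
rewrite /singular_values XX size_sort size_map.
by rewrite (perm_size (eigenvalues_diag d PP)) size_map size_enum_ord.
Qed.

(** Diagonalization yields the eigenvalues in no particular order while [sigma] sorts them;
    permuting the rows of [P] aligns the two. *)
Lemma gram_sigma m n (X : 'M[R]_(m, n)) : exists P : 'M[R]_n,
  P^T *m P = 1%:M /\
  X^T *m X = P^T *m diag_mx (\row_i sigma X i ^+ 2) *m P.
Proof.
have [|P [d [PP XX]]] := @spectral_sym R n (X^T *m X).
  by rewrite trmx_mul trmxK.
have PP' : P *m P^T = 1%:M by apply: mulmx1C.
have d0 i : 0 <= d 0 i.
  have -> : d 0 i = sqn (X *m (row i P)^T).
    have : diag_mx d = P *m (X^T *m X) *m P^T.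
      by rewrite XX !mulmxA PP' mul1mx -mulmxA PP' mulmx1.
    move/(congr1 (fun M : 'M[R]_n => M i i)); rewrite mxE eqxx mulr1n => ->.
    rewrite /sqn /inner trmx_mul trmxK /mxtrace big_ord1.
    rewrite !mulmxA -!row_mul [LHS]mxE 2![RHS]mxE; apply: eq_bigr => k _.
    by congr (_ * _); rewrite !mxE.
  exact: sqn_ge0.
pose t := [tuple Num.sqrt (d 0 i) | i < n].
have /tuple_permP[p sp] : perm_eq (singular_values X) t.
  rewrite /singular_values perm_sort XX.
  rewrite (_ : val t = [seq Num.sqrt x | x <- [seq d 0 i | i <- enum 'I_n]]).
    exact: perm_map (eigenvalues_diag d PP).
  by rewrite -map_comp.
have sd (i : 'I_n) : sigma X i ^+ 2 = d 0 (p i).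
  rewrite /sigma sp -[RHS]sqr_sqrtr //; congr (_ ^+ 2).
  by rewrite -tnth_nth !tnth_mktuple.
exists (row_perm p P); split.
  rewrite -[RHS]PP; apply/matrixP => i j; rewrite !mxE.
  rewrite [RHS](reindex_inj (@perm_inj _ p)) /=.
  by apply: eq_bigr => k _; rewrite !mxE.
rewrite XX !mul_mx_diag; apply/matrixP => i j; rewrite !mxE.
rewrite [LHS](reindex_inj (@perm_inj _ p)) /=.
by apply: eq_bigr => k _; rewrite !mxE sd.
Qed.

Lemma sigma_default m n (X : 'M[R]_(m, n)) i : (n <= i)%N -> sigma X i = 0.
Proof. by move=> ni; rewrite /sigma nth_default // size_singular_values. Qed.

Lemma sigma_ge0 m n (X : 'M[R]_(m, n)) i : 0 <= sigma X i.
Proof.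
have [ni|ni] := leqP n i; first by rewrite sigma_default.
have : sigma X i \in singular_values X by rewrite mem_nth ?size_singular_values.
by rewrite mem_sort => /mapP[x _ ->]; apply: sqrtr_ge0.
Qed.

Lemma sigma_le m n (X : 'M[R]_(m, n)) i j : (i <= j)%N -> sigma X j <= sigma X i.
Proof.
move=> ij; have [nj|jn] := leqP n j; first by rewrite sigma_default ?sigma_ge0.
have : sorted >=%R (singular_values X).
  by apply: sort_sorted => x y; apply: ge_total.
move/(sorted_leq_nth (@ge_trans _ R) (@lexx _ R) 0) => /(_ i j); apply => //.
  by rewrite inE size_singular_values (leq_ltn_trans ij).
by rewrite inE size_singular_values.
Qed.

(** Subtract the threshold [t], the value of [l] at position [k], or 0 if there is none. The terms
    [(l i - t) * c i] are at most [l i - t] before [k] and nonpositive after it, and [t] times the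
    total weight is at most [t * k]. *)
Lemma sum_sorted_weights_le n (l c : 'I_n -> R) (k : nat) :
  (forall i, 0 <= l i) -> (forall i j : 'I_n, (i <= j)%N -> l j <= l i) ->
  (forall i, 0 <= c i <= 1) -> \sum_i c i <= k%:R -> (k <= n)%N ->
  \sum_i l i * c i <= \sum_(i < n | (i < k)%N) l i.
Proof.
move=> l0 lS c01 ck kn.
have [t [t0 tlo thi]] : exists t, [/\ 0 <= t, forall i : 'I_n, (i < k)%N -> t <= l i &
    forall i : 'I_n, (k <= i)%N -> l i <= t].
  have [kn'|nk] := ltnP k n.
    exists (l (Ordinal kn')); split=> // i ik; apply: lS => //.
    exact: ltnW.
  exists 0; split=> // i ki; have := leq_trans nk ki.
  by rewrite leqNgt ltn_ord.
have -> : \sum_i l i * c i = \sum_i (l i - t) * c i + t * \sum_i c i.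
  by rewrite mulr_sumr -big_split; apply: eq_bigr => i _ /=; ring.
apply: le_trans (_ : \sum_(i < n | (i < k)%N) (l i - t) + t * k%:R <= _).
  apply: lerD; last by rewrite ler_wpM2l.
  rewrite [leRHS]big_mkcond /=; apply: ler_sum => i _.
  have /andP[ci0 ci1] := c01 i; case: ltnP => ik.
    by rewrite ler_piMr // subr_ge0 tlo.
  by rewrite mulr_le0_ge0 // subr_le0 thi.
rewrite sumrB -(big_ord_widen _ (fun=> t) kn) sumr_const card_ord mulr_natr.
by rewrite subrK.
Qed.

Lemma sqn_orthl m n p (U : 'M[R]_(m, n)) (M : 'M[R]_(n, p)) :
  U^T *m U = 1%:M -> sqn (U *m M) = sqn M.
Proof. by move=> UU; rewrite /sqn inner_mull mulmxA UU mul1mx. Qed.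

(** The hypothesis makes [Q] a partial isometry, so [M *m Q *m Q^T] projects the rows of [M]
    orthogonally and has the norm of [M *m Q]. *)
Lemma sqn_pisom_le m n k (M : 'M[R]_(m, n)) (Q : 'M[R]_(n, k)) :
  Q *m Q^T *m Q = Q -> sqn (M *m Q) <= sqn M.
Proof.
move=> QQ; have := sqn_ge0 (M - M *m Q *m Q^T).
rewrite sqnB -sqn_tr [sqn (_ *m Q *m _)]/sqn inner_mulr trmxK -!(mulmxA M) QQ.
by rewrite -[inner (M *m Q) _]/(sqn _) mulmxA innerC inner_mulr trmxK -/(sqn _) sqn_tr; lra.
Qed.

Lemma sqn_orth_le m n k (M : 'M[R]_(m, n)) (Q : 'M[R]_(n, k)) :
  Q^T *m Q = 1%:M -> sqn (M *m Q) <= sqn M.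
Proof. by move=> QQ; apply: sqn_pisom_le; rewrite -mulmxA QQ mulmx1. Qed.

Lemma sqn_diag_mul n p (d : 'rV[R]_n) (M : 'M[R]_(n, p)) :
  sqn (diag_mx d *m M) = \sum_i d 0 i ^+ 2 * sqn (row i M).
Proof.
rewrite sqnE; apply: eq_bigr => i _; rewrite sqn_row mulr_sumr.
by apply: eq_bigr => j _; rewrite mul_diag_mx mxE exprMn.
Qed.

Lemma sqn_sum_rows m n (M : 'M[R]_(m, n)) : sqn M = \sum_i sqn (row i M).
Proof. by rewrite sqnE; apply: eq_bigr => i _; rewrite sqn_row. Qed.

Lemma sqn_orth n k (Q : 'M[R]_(n, k)) : Q^T *m Q = 1%:M -> sqn Q = k%:R.
Proof. by move=> QQ; rewrite /sqn /inner QQ mxtrace1. Qed.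

Lemma sqn_mul_gram m n k (X : 'M[R]_(m, n)) (P : 'M[R]_n) (Q : 'M[R]_(n, k)) (d : 'rV[R]_n) :
  X^T *m X = P^T *m diag_mx d *m P ->
  sqn (X *m Q) = \sum_i d 0 i * sqn (row i (P *m Q)).
Proof.
move=> XX; rewrite /sqn inner_mull mulmxA XX -!mulmxA innerC inner_mull trmxK.
rewrite innerE; apply: eq_bigr => i _; rewrite -/(sqn _) sqn_row mulr_sumr.
by apply: eq_bigr => j _; rewrite mul_diag_mx mxE; ring.
Qed.

(** Ky Fan's maximum principle: in an eigenbasis of [X^T *m X] the left side weights the squared
    singular values by the squared row norms of [P *m Q], each at most 1 and with sum [k]. *)
Lemma sqn_mul_orth_le_rnorm2 m n k (X : 'M[R]_(m, n)) (Q : 'M[R]_(n, k)) :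
  (k <= n)%N -> Q^T *m Q = 1%:M -> sqn (X *m Q) <= rnorm2 k X.
Proof.
move=> kn QQ; have [P [PP XX]] := gram_sigma X.
have PP' := mulmx1C PP.
rewrite (sqn_mul_gram _ XX) /rnorm2 (big_ord_widen n (fun i => sigma X i ^+ 2)) //.
under eq_bigr => i _ do rewrite mxE.
apply: sum_sorted_weights_le => //.
- by move=> i; rewrite sqr_ge0.
- by move=> i j ij; rewrite lerXn2r ?nnegrE ?sigma_ge0 ?sigma_le.
- move=> i; rewrite sqn_ge0 /= row_mul; apply: le_trans (sqn_orth_le _ QQ) _.
  rewrite -sqn_tr tr_row (_ : col i P^T = P^T *m delta_mx i 0); last by rewrite colE.
  by rewrite sqn_orthl ?trmxK // /sqn inner_delta mxE !eqxx.
- by rewrite -sqn_sum_rows sqn_orthl // sqn_orth.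
Qed.

Lemma rnorm2_attained m n k (X : 'M[R]_(m, n)) : (k <= n)%N ->
  exists Q : 'M[R]_(n, k), Q^T *m Q = 1%:M /\ sqn (X *m Q) = rnorm2 k X.
Proof.
move=> kn; have [P [PP XX]] := gram_sigma X; have PP' := mulmx1C PP.
pose I : 'M[R]_(n, k) := \matrix_(i, j) (i == j :> nat)%:R.
have II : I^T *m I = 1%:M.
  apply/matrixP => i j; rewrite !mxE (bigD1 (widen_ord kn i)) //= !mxE eqxx mul1r.
  rewrite big1 ?addr0 // => l /negbTE li; rewrite !mxE.
  by rewrite [_ == _ :> nat]li mul0r.
exists (P^T *m I); split.
  by rewrite trmx_mul trmxK -mulmxA (mulmxA P) PP' mul1mx.
rewrite (sqn_mul_gram _ XX) mulmxA PP' mul1mx.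
rewrite /rnorm2 (big_ord_widen n (fun i => sigma X i ^+ 2)) // [RHS]big_mkcond /=.
apply: eq_bigr => i _; rewrite mxE sqn_row; case: ltnP => ik.
  rewrite (bigD1 (Ordinal ik)) //= mxE eqxx expr1n big1 ?addr0 ?mulr1 // => j /negbTE ji.
  by rewrite mxE eq_sym [_ == _ :> nat]ji expr0n.
rewrite big1 ?mulr0 // => j _; rewrite mxE.
by rewrite (_ : (_ == _) = false) ?expr0n //; apply/negbTE; rewrite neq_ltn (leq_trans (ltn_ord j) ik) orbT.
Qed.

End Sigma.

(** * Dual certificates *)

Section Certificate.
Variable R : realType.

Lemma op_le_sqn m n k (W : 'M[R]_(m, n)) t (Q : 'M[R]_(n, k)) :
  op_le W t -> sqn (W *m Q) <= t ^+ 2 * sqn Q.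
Proof.
move=> Wt; rewrite -[sqn (W *m Q)]sqn_tr -[sqn Q]sqn_tr !sqn_sum_rows mulr_sumr.
apply: ler_sum => j _; rewrite -!tr_col !sqn_tr.
by rewrite colE -mulmxA -colE; apply: Wt.
Qed.

Section Factors.
Variables (n1 n2 r : nat) (U : 'M[R]_(n1, r)) (s : 'rV[R]_r) (V : 'M[R]_(n2, r)).
Hypotheses (UU : U^T *m U = 1%:M) (VV : V^T *m V = 1%:M).
Hypothesis s0 : forall i, 0 < s 0 i.

Let X : 'M[R]_(n1, n2) := U *m diag_mx s *m V^T.
Let S2 : R := \sum_i s 0 i ^+ 2.

Lemma orth_width : (r <= n2)%N.
Proof.
by have := mxrankM_maxl V^T V; rewrite VV mxrank1 mxrank_tr => /leq_trans; apply; exact: rank_leq_row.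
Qed.

Lemma sqn_orth_row k (Q : 'M[R]_(n2, k)) i : Q *m Q^T *m Q = Q ->
  sqn (row i (V^T *m Q)) <= 1.
Proof.
move=> QQ; rewrite row_mul; apply: le_trans (sqn_pisom_le _ QQ) _.
rewrite -sqn_tr tr_row trmxK colE sqn_orthl //.
by rewrite /sqn inner_delta mxE !eqxx.
Qed.

Lemma sqn_Vt_le k (Q : 'M[R]_(n2, k)) : sqn (V^T *m Q) <= sqn Q.
Proof.
by rewrite -sqn_tr trmx_mul trmxK -[leRHS]sqn_tr; apply: sqn_orth_le.
Qed.

Lemma sqn_svd_mul k (Q : 'M[R]_(n2, k)) :
  sqn (X *m Q) = \sum_i s 0 i ^+ 2 * sqn (row i (V^T *m Q)).
Proof. by rewrite /X -!mulmxA sqn_orthl // sqn_diag_mul. Qed.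

Lemma sqn_svd : sqn X = S2.
Proof.
rewrite -[X]mulmx1 sqn_svd_mul mulmx1; apply: eq_bigr => i _.
rewrite -sqn_tr tr_row trmxK colE sqn_orthl //.
by rewrite /sqn inner_delta mxE !eqxx mulr1.
Qed.

Section Perturbation.
Variables (W : 'M[R]_(n1, n2)) (t : R).
Hypotheses (UW : U^T *m W = 0) (WV : W *m V = 0).
Hypotheses (Wt : op_le W t) (t0 : 0 <= t) (ts : forall i, t <= s 0 i).

(** The cross term vanishes because [U^T *m W = 0], and [W] only sees the part [Q'] of [Q]
    orthogonal to [V]. With [c i <= 1] the squared row norms of [V^T *m Q], the left side is at most
    the sum of [s 0 i ^+ 2 * c i] plus [t ^+ 2 * (sqn Q - \sum_i c i)]. As [t <= s 0 i], spending
    the budget [r] on the rows of [V^T] is optimal. *)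
Lemma sqn_perturbed_mul_le k (Q : 'M[R]_(n2, k)) :
  Q *m Q^T *m Q = Q -> sqn Q <= r%:R -> sqn ((X + W) *m Q) <= S2.
Proof.
move=> QQ Qr; rewrite mulmxDl sqnD.
have -> : inner (X *m Q) (W *m Q) = 0.
  by rewrite /X -!mulmxA inner_mull (mulmxA U^T) UW mul0mx inner0r.
rewrite mulr0 addr0 sqn_svd_mul.
pose Q' := Q - V *m (V^T *m Q).
have -> : W *m Q = W *m Q' by rewrite mulmxBr (mulmxA W V) WV mul0mx subr0.
have Q'E : sqn Q' = sqn Q - \sum_i sqn (row i (V^T *m Q)).
  rewrite -sqn_sum_rows sqnB innerC inner_mull sqn_orthl // /sqn; ring.
have := op_le_sqn Q' Wt; rewrite Q'E => WQ.
have : \sum_i (s 0 i ^+ 2 - t ^+ 2) * sqn (row i (V^T *m Q)) <=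
       \sum_i (s 0 i ^+ 2 - t ^+ 2).
  apply: ler_sum => i _; rewrite ler_piMr ?sqn_orth_row //.
  by rewrite subr_ge0 lerXn2r ?nnegrE ?(ltW (s0 i)).
rewrite sumrB sumr_const card_ord -/S2.
under eq_bigr => i _ do rewrite mulrBl.
rewrite sumrB -mulr_sumr => H.
have : t ^+ 2 * sqn Q <= t ^+ 2 *+ r by rewrite -mulr_natr ler_wpM2l ?sqr_ge0.
by move: H WQ; rewrite mulrBr; lra.
Qed.

Lemma rnorm2_perturbed_le : rnorm2 r (X + W) <= S2.
Proof.
have [Q [QQ <-]] := rnorm2_attained (X + W) orth_width.
by apply: sqn_perturbed_mul_le; rewrite -?mulmxA ?QQ ?mulmx1 ?sqn_orth.
Qed.

(* A partial isometry [Q] with [A *m B = N *m Q^T] replaces the projection on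
   the row space of [A *m B]. *)
Lemma eckart_young (A : 'M[R]_(n1, r)) (B : 'M[R]_(r, n2)) :
  inner (X + W) (A *m B) - 2^-1 * sqn (A *m B) <= 2^-1 * S2.
Proof.
have [|P [d [PP BB]]] := @spectral_sym R r (B *m B^T).
  by rewrite trmx_mul trmxK.
have PP' := mulmx1C PP; pose C := P *m B.
have CC : C *m C^T = diag_mx d.
  rewrite /C trmx_mul mulmxA -(mulmxA P) BB !mulmxA PP' mul1mx.
  by rewrite -mulmxA PP' mulmx1.
have dC i : d 0 i = sqn (row i C).
  have := congr1 (fun M : 'M[R]_r => M i i) CC; rewrite !mxE eqxx mulr1n sqn_row => <-.
  by apply: eq_bigr => j _; rewrite [C^T _ _]mxE.
have d0 i : 0 <= d 0 i by rewrite dC sqn_ge0.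
(* Since the inverse of 0 is 0, [e] is a pseudo-inverse of [h] and [f] marks the nonzero [d 0 i].
   Hence [Q] is a partial isometry even when [B] is rank deficient. *)
pose e := \row_i (Num.sqrt (d 0 i))^-1.
pose h := \row_i Num.sqrt (d 0 i).
pose f := \row_i (d 0 i != 0)%:R : 'rV[R]_r.
pose Q := C^T *m diag_mx e.
have QQ : Q^T *m Q = diag_mx f.
  rewrite /Q trmx_mul trmxK tr_diag_mx mulmxA -(mulmxA _ C) CC !mulmx_diag.
  congr diag_mx; apply/rowP => i; rewrite !mxE.
  case: eqVneq => [->|di]; first by rewrite mulr0 mul0r.
  rewrite mulrAC -invfM -expr2 sqr_sqrtr // mulVf //.
have Qf : Q *m diag_mx f = Q.
  rewrite /Q -mulmxA mulmx_diag; congr (_ *m diag_mx _); apply/rowP => i.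
  rewrite !mxE; case: eqVneq => [->|]; last by rewrite mulr1.
  by rewrite sqrtr0 invr0 mul0r.
have Ch : C = diag_mx h *m Q^T.
  rewrite /Q trmx_mul trmxK tr_diag_mx mulmxA mulmx_diag mul_diag_mx.
  apply/matrixP => i j; rewrite !mxE.
  case: (eqVneq (d 0 i) 0) => [di|di]; last by rewrite divff ?mul1r // sqrtr_eq0 -ltNge lt_def di d0.
  have := congr1 (fun M : 'rV[R]_n2 => M 0 j) (sqn_eq0 (etrans (esym (dC i)) di)).
  by rewrite !mxE => ->; rewrite mulr0.
pose N := A *m P^T *m diag_mx h.
have ABN : A *m B = N *m Q^T.
  by rewrite /N -mulmxA -Ch /C -mulmxA (mulmxA P^T) PP mul1mx.
have QQQ : Q *m Q^T *m Q = Q by rewrite -mulmxA QQ Qf.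
have Qr : sqn Q <= r%:R.
  rewrite /sqn /inner QQ mxtrace_diag -[r in leRHS]card_ord -sumr_const.
  by apply: ler_sum => i _; rewrite mxE lern1 leq_b1.
have le1 := sqn_perturbed_mul_le QQQ Qr.
have -> : inner (X + W) (A *m B) = inner (N *m diag_mx f) ((X + W) *m Q).
  rewrite ABN innerC inner_mulr trmxK -[in LHS]Qf mulmxA.
  by rewrite innerC inner_mulr tr_diag_mx innerC.
have -> : sqn (A *m B) = sqn (N *m diag_mx f).
  rewrite ABN /sqn [LHS]inner_mulr [RHS]inner_mulr trmxK -!(mulmxA N) QQ tr_diag_mx mulmx_diag.
  congr (inner _ (_ *m diag_mx _)); apply/rowP => i; rewrite !mxE.
  by case: eqP; rewrite ?mulr0 ?mulr1.
by have := inner_le (N *m diag_mx f) ((X + W) *m Q); lra.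
Qed.

End Perturbation.

(** The pairing with [X] depends only on [M *m V], whose squared norm is at most [rnorm2 r M]; the
    rest is the arithmetic-geometric inequality. This bounds the objective at [X] from above. *)
Lemma inner_svd_le (M : 'M[R]_(n1, n2)) :
  inner X M - 2^-1 * rnorm2 r M <= 2^-1 * S2.
Proof.
have -> : inner X M = inner (U *m diag_mx s) (M *m V) by rewrite /X inner_mulr trmxK.
have := inner_le (U *m diag_mx s) (M *m V).
have -> : sqn (U *m diag_mx s) = S2.
  rewrite sqn_orthl // -[diag_mx s]mulmx1 sqn_diag_mul; apply: eq_bigr => i _.
  by rewrite rowE mulmx1 /sqn inner_delta mxE !eqxx mulr1.
by have := sqn_mul_orth_le_rnorm2 M orth_width VV; lra.
Qed.

Lemma rnorm2_svd k : (forall i j : 'I_r, (i <= j)%N -> s 0 j <= s 0 i) ->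
  (k <= r)%N -> rnorm2 k X = \sum_(i < r | (i < k)%N) s 0 i ^+ 2.
Proof.
move=> sS kr; have kn := leq_trans kr orth_width.
apply/eqP; rewrite eq_le; apply/andP; split.
  have [Q [QQ <-]] := rnorm2_attained X kn.
  have QQQ : Q *m Q^T *m Q = Q by rewrite -mulmxA QQ mulmx1.
  rewrite sqn_svd_mul; apply: sum_sorted_weights_le => //.
  - by move=> i; rewrite sqr_ge0.
  - by move=> i j ij; rewrite lerXn2r ?nnegrE ?(ltW (s0 _)) ?sS.
  - by move=> i; rewrite sqn_ge0 sqn_orth_row.
  - by rewrite -sqn_sum_rows -(sqn_orth QQ) sqn_Vt_le.
pose I : 'M[R]_(r, k) := \matrix_(i, j) (i == j :> nat)%:R.
have II : I^T *m I = 1%:M.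
  apply/matrixP => i j; rewrite !mxE (bigD1 (widen_ord kr i)) //= !mxE eqxx mul1r.
  rewrite big1 ?addr0 // => l /negbTE li; rewrite !mxE.
  by rewrite [_ == _ :> nat]li mul0r.
have QQ : (V *m I)^T *m (V *m I) = 1%:M.
  by rewrite trmx_mul mulmxA -(mulmxA _ V^T) VV mulmx1.
apply: le_trans (sqn_mul_orth_le_rnorm2 X kn QQ).
rewrite sqn_svd_mul mulmxA VV mul1mx big_mkcond /=; apply: ler_sum => i _.
case: ltnP => ik; last by rewrite mulr_ge0 ?sqn_ge0 ?sqr_ge0.
rewrite sqn_row (bigD1 (Ordinal ik)) //= mxE eqxx expr1n big1 ?addr0 ?mulr1 // => j /negbTE ji.
by rewrite mxE eq_sym [_ == _ :> nat]ji expr0n.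
Qed.

(** Successive differences of the partial sums in [rnorm2_svd] isolate one squared singular value,
    without computing the characteristic polynomial of [X^T *m X]. It links [condition_number] to
    the given decomposition. *)
Lemma sigma_svd (i : 'I_r) : (forall i j : 'I_r, (i <= j)%N -> s 0 j <= s 0 i) ->
  sigma X i = s 0 i.
Proof.
move=> sS; have := rnorm2_svd sS (ltn_ord i).
rewrite /rnorm2 big_ord_recr /= -/(rnorm2 i X) (rnorm2_svd sS (ltnW (ltn_ord i))).
rewrite [RHS](bigD1 i) //= [RHS]addrC [X in _ = X + _](eq_bigl (fun j : 'I_r => (j < i)%N)); last first.
  by move=> j; rewrite ltnS ltn_neqAle andbC.
move/addrI => H; apply/eqP; rewrite -(eqrXn2 (n := 2)) ?sigma_ge0 ?(ltW (s0 i)) //.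
by rewrite H.
Qed.

End Factors.
End Certificate.

(** * Recovery and duality from a certificate *)

Section Conclusion.
Variables (R : realType) (n1 n2 r : nat).
Variables (U : 'M[R]_(n1, r)) (s : 'rV[R]_r) (V : 'M[R]_(n2, r)).
Hypotheses (UU : U^T *m U = 1%:M) (VV : V^T *m V = 1%:M).
Hypothesis s0 : forall i, 0 < s 0 i.

Let X : 'M[R]_(n1, n2) := U *m diag_mx s *m V^T.
Let S2 : R := \sum_i s 0 i ^+ 2.

Definition tangent_compl (M : 'M[R]_(n1, n2)) :=
  (1%:M - U *m U^T) *m M *m (1%:M - V *m V^T).

Variables (Omega : {set 'I_n1 * 'I_n2}) (W : 'M[R]_(n1, n2)) (t : R).
Hypotheses (UW : U^T *m W = 0) (WV : W *m V = 0).
Hypotheses (Wt : op_le W t) (t0 : 0 <= t) (ts : forall i, t < s 0 i).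
Hypothesis YOmega : proj_Omega Omega (X + W) = X + W.
Hypothesis inj : forall D, proj_Omega Omega D = 0 -> tangent_compl D = 0 -> D = 0.

Lemma inner_proj_Omega (M N : 'M[R]_(n1, n2)) :
  inner M (proj_Omega Omega N) = inner (proj_Omega Omega M) N.
Proof.
rewrite !innerE; apply: eq_bigr => i _; apply: eq_bigr => j _.
by rewrite !mxE; case: ifP; rewrite ?mulr0 ?mul0r.
Qed.

(** Being supported on [Omega], the certificate [X + W] pairs identically with all feasible
    matrices, so the value can be read off at [X]. *)
Lemma inner_feasible (M : 'M[R]_(n1, n2)) : feasible Omega X M ->
  inner M (X + W) = S2.
Proof.
rewrite /feasible /= => MX.
have -> : inner M (X + W) = inner X (X + W).
  by rewrite -YOmega !inner_proj_Omega MX.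
rewrite innerDr -/(sqn X) sqn_svd // {1}/X -mulmxA inner_mull UW inner0r.
by rewrite addr0.
Qed.

Lemma rstar_svd_le : (rstar r X <= (2^-1 * S2)%:E)%E.
Proof.
apply: ge_ereal_sup => _ [M _ <-]; rewrite lee_fin.
exact: inner_svd_le.
Qed.

Lemma rstar_ge (M N : 'M[R]_(n1, n2)) : (((inner M N - 2^-1 * rnorm2 r N)%:E) <= rstar r M)%E.
Proof. by apply: ereal_sup_ubound; exists N. Qed.

Lemma rstar_feasible_ge (M : 'M[R]_(n1, n2)) : feasible Omega X M ->
  ((2^-1 * S2)%:E <= rstar r M)%E.
Proof.
move=> MX; apply: le_trans (rstar_ge M (X + W)); rewrite lee_fin inner_feasible //.
have := rnorm2_perturbed_le UU VV s0 UW WV Wt t0 (fun i => ltW (ts i)).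
by rewrite -/X -/S2; lra.
Qed.

Lemma op_leD (A B : 'M[R]_(n1, n2)) a b : 0 <= a -> 0 <= b ->
  op_le A a -> op_le B b -> op_le (A + B) (a + b).
Proof.
move=> a0 b0 Aa Bb y; rewrite mulmxDl sqnD.
have ly : sqn y = Num.sqrt (sqn y) ^+ 2 by rewrite sqr_sqrtr ?sqn_ge0.
have yp := sqrtr_ge0 (sqn y); rewrite ly.
have A' : sqn (A *m y) <= (a * Num.sqrt (sqn y)) ^+ 2 by rewrite exprMn -ly.
have B' : sqn (B *m y) <= (b * Num.sqrt (sqn y)) ^+ 2 by rewrite exprMn -ly.
have := inner_abs_le (mulr_ge0 a0 yp) (mulr_ge0 b0 yp) A' B'.
move: (ler_norm (inner (A *m y) (B *m y))) A' B'; lra.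
Qed.

Lemma op_leZ (A : 'M[R]_(n1, n2)) a c : op_le A a -> op_le (c *: A) (c * a).
Proof.
by move=> Aa y; rewrite -scalemxAl sqnZ exprMn -[leRHS]mulrA ler_wpM2l ?sqr_ge0.
Qed.

Lemma op_le_sqrt (A : 'M[R]_(n1, n2)) : op_le A (Num.sqrt (sqn A)).
Proof. by move=> y; rewrite sqr_sqrtr ?sqn_ge0 // sqn_mulmx_le. Qed.

Lemma min_gap : exists2 e : R, 0 < e & forall i, t + e <= s 0 i.
Proof.
pose e := \big[Num.min/1]_i (s 0 i - t).
exists e; first by rewrite /e; apply: lt_bigmin => // i _; rewrite subr_gt0.
by move=> i; rewrite -lerBrDl /e; apply: bigmin_le_cond.
Qed.

Lemma UtC (M : 'M[R]_(n1, n2)) : U^T *m tangent_compl M = 0.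
Proof.
rewrite /tangent_compl -(mulmxA _ M) (mulmxA U^T) mulmxBr (mulmxA U^T) UU.
by rewrite mul1mx mulmx1 subrr mul0mx.
Qed.

Lemma tCV (M : 'M[R]_(n1, n2)) : tangent_compl M *m V = 0.
Proof.
rewrite /tangent_compl -(mulmxA _ _ V) [_ *m V]mulmxBl -(mulmxA V) VV.
by rewrite mul1mx mulmx1 subrr mulmx0.
Qed.

Lemma inner_tangent_compl (M : 'M[R]_(n1, n2)) :
  inner M (tangent_compl M) = sqn (tangent_compl M).
Proof.
set G := tangent_compl M; rewrite /sqn {2}/G /tangent_compl.
rewrite inner_mulr linearB /= trmx1 trmx_mul trmxK.
rewrite [G *m _]mulmxBr mulmx1 mulmxA tCV mul0mx subr0.
rewrite inner_mull linearB /= trmx1 trmx_mul trmxK.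
by rewrite mulmxBl mul1mx -mulmxA UtC mulmx0 subr0.
Qed.

Lemma argmin_rstar : argmin (rstar r) (feasible Omega X) = [set X]%classic.
Proof.
have XX : feasible Omega X X by [].
apply/seteqP; split => [M [MX Mmin]|_ ->]; last first.
  split => // M /rstar_feasible_ge; apply: le_trans; exact: rstar_svd_le.
have MS : (rstar r M <= (2^-1 * S2)%:E)%E by apply: le_trans (Mmin X XX) rstar_svd_le.
have [e e0 te] := min_gap.
(* Perturb the certificate by [c *: G]. The Frobenius norm of [c *: G] is at most the gap [e], so
   [rnorm2] stays at most [S2], while the pairing with [M] gains [c * sqn G]. Minimality of [M]
   forces [G = 0], and [inj] applies to [M - X]. *)
pose G := tangent_compl (M - X); pose c := e / (Num.sqrt (sqn G) + 1).
have g0 : 0 < Num.sqrt (sqn G) + 1 by rewrite ltr_wpDl ?sqrtr_ge0.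
have c0 : 0 < c by rewrite divr_gt0.
have UWG : U^T *m (W + c *: G) = 0 by rewrite mulmxDr UW -scalemxAr UtC scaler0 addr0.
have WGV : (W + c *: G) *m V = 0 by rewrite mulmxDl WV -scalemxAl tCV scaler0 addr0.
have cg0 : 0 <= c * Num.sqrt (sqn G) by rewrite mulr_ge0 ?sqrtr_ge0 ?ltW.
have WGt : op_le (W + c *: G) (t + c * Num.sqrt (sqn G)).
  by apply: op_leD => //; apply: op_leZ; apply: op_le_sqrt.
have ce : c * Num.sqrt (sqn G) <= e.
  by rewrite /c mulrAC ler_pdivrMr // ler_wpM2l ?ltW // ltrDl.
have tg i : t + c * Num.sqrt (sqn G) <= s 0 i by apply: le_trans (te i); rewrite lerD2l.
have := rnorm2_perturbed_le UU VV s0 UWG WGV WGt (addr_ge0 t0 cg0) tg.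
rewrite -/X -/S2 => rY.
have MG : inner M G = sqn G.
  rewrite -inner_tangent_compl -/G innerBl.
  have -> : inner X G = 0 by rewrite /X -mulmxA inner_mull UtC inner0r.
  by rewrite subr0.
have MY : inner M (X + (W + c *: G)) = S2 + c * sqn G.
  by rewrite addrA innerDr inner_feasible // innerZr MG.
have := le_trans (rstar_ge M (X + (W + c *: G))) MS; rewrite lee_fin MY => H.
have cG : c * sqn G <= 0 by move: H rY; lra.
have G0 : sqn G = 0.
  by apply/eqP; rewrite eq_le sqn_ge0 andbT -(pmulr_rle0 _ c0).
apply/eqP; rewrite -subr_eq0; apply/eqP/inj; last exact: sqn_eq0 G0.
apply/matrixP => i j; move/matrixP/(_ i j): MX; rewrite !mxE.
by case: ifP => // _ ->; rewrite subrr.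
Qed.

(** The factors of [X] and [Lam = - (X + W)] form a saddle point of value [2^-1 * S2]: [lagr_le]
    bounds the Lagrangian above at these factors, by testing the conjugate at [X], and [lagr_ge]
    bounds it below at [Lam], by [eckart_young]. A saddle point attains both outer optima. *)
Lemma strong_duality_feasible : strong_duality r (indicator R (feasible Omega X)).
Proof.
set H := indicator R _.
have XX : feasible Omega X X by [].
have HX : H X = 0%E by rewrite /H /indicator mem_set.
pose Lam := - (X + W).
have conj_ge L : ((inner L X)%:E <= conjugate H L)%E.
  by apply: ereal_sup_ubound; exists X => //; rewrite HX sube0.
have conj_Lam : (conjugate H Lam <= (- S2)%:E)%E.
  apply: ge_ereal_sup => _ [M _ <-]; rewrite /H /indicator.
  case: ifPn => [|_]; last by rewrite leNye.
  rewrite inE => MX; rewrite sube0 lee_fin innerC innerNr inner_feasible //.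
have lagr_le L : (lagrangian H (U *m diag_mx s) V^T L <= (2^-1 * S2)%:E)%E.
  rewrite /lagrangian -/X !fnorm_sqn -opprD -scaleN1r sqnZ sqrrN expr1n mul1r sqnD sqn_svd //.
  case: (conjugate H L) (conj_ge L) => [c| |] //=; rewrite ?leNye // !lee_fin.
  by rewrite -/S2; lra.
have lagr_ge (A : 'M[R]_(n1, r)) (B : 'M[R]_(r, n2)) :
    ((2^-1 * S2)%:E <= lagrangian H A B Lam)%E.
  rewrite /lagrangian !fnorm_sqn opprK sqnB.
  have -> : sqn Lam = sqn (X + W) by rewrite /Lam -scaleN1r sqnZ sqrrN expr1n mul1r.
  have := eckart_young UU VV s0 UW WV Wt t0 (fun i => ltW (ts i)) A B.
  rewrite -/X -/S2 => EY.
  case: (conjugate H Lam) conj_Lam => [c| |] //=; rewrite ?leey // !lee_fin.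
  by move: EY; lra.
exists (2^-1 * S2)%:E; split; split.
- exists (U *m diag_mx s, V^T) => //; apply/eqP; rewrite eq_le; apply/andP; split.
    by apply: ge_ereal_sup => _ [L _ <-]; apply: lagr_le.
  by apply: le_trans (lagr_ge _ _) _; apply: ereal_sup_ubound; exists Lam.
- move=> _ [[A B] _ <-]; apply: le_trans (lagr_ge A B) _.
  by apply: ereal_sup_ubound; exists Lam.
- exists Lam => //; apply/eqP; rewrite eq_le; apply/andP; split.
    apply: le_trans (lagr_le Lam); apply: ereal_inf_lbound.
    by exists (U *m diag_mx s, V^T).
  by apply: le_ereal_inf_tmp => _ [[A B] _ <-]; apply: lagr_ge.
- move=> _ [L _ <-]; apply: le_trans (lagr_le L); apply: ereal_inf_lbound.
  by exists (U *m diag_mx s, V^T).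
Qed.

End Conclusion.

(** * Golfing *)

Section Tangent.
Variable R : realType.

Definition tangent n1 n2 r (U : 'M[R]_(n1, r)) (V : 'M[R]_(n2, r)) M :=
  M - tangent_compl U V M.

Lemma mul_delta_mul m n p q (A : 'M[R]_(m, n)) (B : 'M[R]_(p, q)) i j k l :
  (A *m delta_mx i j *m B) k l = A k i * B j l.
Proof.
by rewrite -(mul_delta_mx (0 : 'I_1)) mulmxA -colE -mulmxA -rowE mxE big_ord1 !mxE.
Qed.

Lemma trmx_proj_compl n r (A : 'M[R]_(n, r)) :
  (1%:M - A *m A^T)^T = 1%:M - A *m A^T.
Proof. by rewrite linearB /= trmx1 trmx_mul trmxK. Qed.

Lemma sqn_proj_compl_le n r p (A : 'M[R]_(n, r)) (x : 'M[R]_(n, p)) :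
  A^T *m A = 1%:M -> sqn ((1%:M - A *m A^T) *m x) <= sqn x.
Proof.
move=> AA; rewrite mulmxBl mul1mx -mulmxA sqnB innerC inner_mull sqn_orthl //.
by have := sqn_ge0 (A^T *m x); rewrite /sqn; lra.
Qed.

Section Linear.
Variables (n1 n2 r : nat) (U : 'M[R]_(n1, r)) (V : 'M[R]_(n2, r)).
Notation tc := (tangent_compl U V).
Notation PT := (tangent U V).

Lemma tangent_compl_is_linear : linear tc.
Proof.
by move=> a M N; rewrite /tangent_compl (mulmxDr (1%:M - U *m U^T)) [LHS]mulmxDl -scalemxAr -scalemxAl.
Qed.

HB.instance Definition _ := GRing.isLinear.Build R 'M[R]_(n1, n2) 'M[R]_(n1, n2) *:%R tc
  tangent_compl_is_linear.

Lemma tangent_is_linear : linear PT.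
Proof. by move=> a M N; rewrite /tangent linearP scalerBr opprD addrACA. Qed.

HB.instance Definition _ := GRing.isLinear.Build R 'M[R]_(n1, n2) 'M[R]_(n1, n2) *:%R PT
  tangent_is_linear.

Lemma inner_tc_sym M N : inner (tc M) N = inner M (tc N).
Proof.
by rewrite /tangent_compl inner_mulr inner_mull !trmx_proj_compl mulmxA.
Qed.

Lemma inner_tangent_sym M N : inner (PT M) N = inner M (PT N).
Proof. by rewrite innerBl innerBr inner_tc_sym. Qed.

Hypotheses (UU : U^T *m U = 1%:M) (VV : V^T *m V = 1%:M).

Lemma tc_idem M : tc (tc M) = tc M.
Proof.
rewrite {1}/tangent_compl mulmxBl mul1mx -mulmxA UtC // mulmx0 subr0.
by rewrite mulmxBr mulmx1 mulmxA tCV // mul0mx subr0.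
Qed.

Lemma tangent_idem M : PT (PT M) = PT M.
Proof. by rewrite {1}/tangent linearB /= tc_idem subrr subr0. Qed.

Lemma tc_tangent M : tc (PT M) = 0.
Proof. by rewrite linearB /= tc_idem subrr. Qed.

Lemma op_le_tc M t : op_le M t -> op_le (tc M) t.
Proof.
move=> Mt y; have -> : tc M *m y = (1%:M - U *m U^T) *m (M *m ((1%:M - V *m V^T) *m y)).
  by rewrite /tangent_compl !mulmxA.
apply: le_trans (sqn_proj_compl_le _ UU) _.
apply: le_trans (Mt _) _; rewrite ler_wpM2l ?sqr_ge0 //.
exact: sqn_proj_compl_le.
Qed.

Lemma tangent_svd (d : 'rV[R]_r) :
  PT (U *m diag_mx d *m V^T) = U *m diag_mx d *m V^T.
Proof.
rewrite /tangent /tangent_compl (_ : (1%:M - U *m U^T) *m _ = 0) ?mul0mx ?subr0 //.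
by rewrite mulmxBl mul1mx !mulmxA -(mulmxA U U^T) UU mulmx1 subrr.
Qed.

End Linear.

Lemma tangent_tr n1 n2 r (U : 'M[R]_(n1, r)) (V : 'M[R]_(n2, r)) M :
  (tangent U V M)^T = tangent V U M^T.
Proof.
by rewrite /tangent /tangent_compl linearB /= !trmx_mul !trmx_proj_compl mulmxA.
Qed.

Section Delta.
Variables (n1 n2 r : nat) (U : 'M[R]_(n1, r)) (V : 'M[R]_(n2, r)).
Hypotheses (UU : U^T *m U = 1%:M) (VV : V^T *m V = 1%:M).
Variable w : R.
Hypotheses (w01 : 0 < w <= 1).
Hypothesis (Uw : forall i, sqn (row i U) <= w ^+ 2).
Hypothesis (Vw : forall j, sqn (row j V) <= w ^+ 2).
Notation PT := (tangent U V).

Lemma projE m (A : 'M[R]_(m, r)) i j : (A *m A^T) i j = inner (row i A) (row j A).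
Proof.
rewrite innerE big_ord1 mxE; apply: eq_bigr => k _.
by rewrite [A^T _ _]mxE !mxE.
Qed.

Lemma tangent_deltaE i j k l : PT (delta_mx i j) k l =
  ((k == i) && (l == j))%:R -
  ((k == i)%:R - (U *m U^T) k i) * ((j == l)%:R - (V *m V^T) j l).
Proof.
have subE m n (A B : 'M[R]_(m, n)) a b : (A - B) a b = A a b - B a b by rewrite !mxE.
have idE n (a b : 'I_n) : (1%:M : 'M[R]_n) a b = (a == b)%:R by rewrite mxE.
by rewrite /tangent /tangent_compl subE mul_delta_mul !subE !idE mxE.
Qed.

Lemma tangent_delta_diag i j :
  PT (delta_mx i j) i j = 1 - (1 - sqn (row i U)) * (1 - sqn (row j V)).
Proof. by rewrite tangent_deltaE !eqxx !projE. Qed.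

Lemma sqn_tangent_delta i j : sqn (PT (delta_mx i j)) <= 2 * w ^+ 2.
Proof.
rewrite /sqn inner_tangent_sym tangent_idem // inner_delta tangent_delta_diag.
have := sqn_ge0 (row i U); have := sqn_ge0 (row j V); move: (Uw i) (Vw j).
by move: (sqn _) (sqn _) => u v; nra.
Qed.

Lemma tangent_delta_sym (e f : 'I_n1 * 'I_n2) :
  PT (delta_mx e.1 e.2) f.1 f.2 = PT (delta_mx f.1 f.2) e.1 e.2.
Proof. by rewrite -!inner_delta -inner_tangent_sym innerC. Qed.

Lemma tangent_delta_le i j k l : `|PT (delta_mx i j) k l| <= 2 * w ^+ 2.
Proof.
have w2 : 0 <= 2 * w ^+ 2 by rewrite mulr_ge0 ?sqr_ge0.
rewrite -inner_delta -(tangent_idem UU VV) -inner_tangent_sym.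
rewrite -[leRHS]sqr_sqrtr // expr2.
by apply: inner_abs_le; rewrite ?sqrtr_ge0 ?sqr_sqrtr ?sqn_tangent_delta.
Qed.

Lemma proj_le i k : `|(U *m U^T) i k| <= w ^+ 2.
Proof.
have w0 : 0 <= w by apply: ltW; case/andP: w01.
by rewrite projE expr2; apply: inner_abs_le.
Qed.

Lemma proj_row_le i : \sum_k (U *m U^T) i k ^+ 2 <= w ^+ 2.
Proof.
rewrite -sqn_row row_mul -sqn_tr trmx_mul trmxK sqn_orthl // sqn_tr.
exact: Uw.
Qed.

(** Row [i] of the projected unit is [(U U^T) i a] times the part of the basis row orthogonal to
    [V], of norm at most 1, plus, if [i = a], its part in the span of [V], of norm at most [w].
    Keeping the dependence on [i] and [a] lets line norms of the residual bound the variance. *)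
Lemma sqn_row_tangent_delta i a b :
  sqn (row i (PT (delta_mx a b))) <= 2 * ((U *m U^T) i a ^+ 2 + (i == a)%:R * w ^+ 2).
Proof.
set P := V *m V^T; set e : 'rV[R]_n2 := delta_mx 0 b.
have eP : sqn (e *m P) <= w ^+ 2.
  rewrite /P mulmxA -sqn_tr trmx_mul trmxK sqn_orthl // sqn_tr -rowE; exact: Vw.
have e1 : sqn e = 1 by rewrite /sqn inner_delta mxE !eqxx.
have eQ : sqn (e - e *m P) <= 1.
  have PP : P *m P^T = P by rewrite /P trmx_mul trmxK mulmxA -(mulmxA V) VV mulmx1.
  have : inner e (e *m P) = sqn (e *m P) by rewrite [RHS]/sqn [RHS]inner_mulr -mulmxA PP.
  by rewrite sqnB e1 => ->; have := sqn_ge0 (e *m P); lra.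
have -> : row i (PT (delta_mx a b)) =
    (U *m U^T) i a *: (e - e *m P) + (i == a)%:R *: (e *m P).
  apply/rowP => l; rewrite [LHS]mxE tangent_deltaE.
  have eE : (e *m P) 0 l = P b l by rewrite /e -rowE mxE.
  have zE (x : 'rV[R]_n2) c : (c *: x) 0 l = c * x 0 l by rewrite mxE.
  rewrite [RHS]mxE !zE [(e - _) 0 l]mxE [(- (e *m P)) 0 l]mxE eE [e 0 l]mxE eqxx /= (eq_sym b l).
  by case: (i == a); case: (l == b) => /=; ring.
apply: le_trans (_ : 2 * (sqn ((U *m U^T) i a *: (e - e *m P)) + sqn ((i == a)%:R *: (e *m P))) <= _).
  by have := sqn_ge0 ((U *m U^T) i a *: (e - e *m P) - (i == a)%:R *: (e *m P)); rewrite sqnB sqnD; lra.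
rewrite !sqnZ ler_wpM2l //; apply: lerD; first by rewrite ler_piMr ?sqr_ge0.
by case: (i == a); rewrite ?expr1n ?mul1r ?expr0n ?mul0r.
Qed.

End Delta.
End Tangent.

(** * One golfing step and its iteration *)

Section Golfing.
Variables (R : realType) (n1 n2 r : nat) (U : 'M[R]_(n1, r)) (V : 'M[R]_(n2, r)).
Hypotheses (UU : U^T *m U = 1%:M) (VV : V^T *m V = 1%:M).
Variable w : R.
Hypotheses (w01 : 0 < w <= 1).
Hypothesis (Uw : forall i, sqn (row i U) <= w ^+ 2).
Hypothesis (Vw : forall j, sqn (row j V) <= w ^+ 2).
Notation PT := (tangent U V).
Notation tc := (tangent_compl U V).
Let E : finType := ('I_n1 * 'I_n2)%type.

(* [b] bounds simultaneously [|Z|_oo / w] and the Euclidean norms of all rows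
   and columns of [Z]. *)
Definition norms_le (b : R) (Z : 'M[R]_(n1, n2)) :=
  [/\ forall i j, `|Z i j| <= b * w,
      forall i, \sum_j Z i j ^+ 2 <= b ^+ 2 &
      forall j, \sum_i Z i j ^+ 2 <= b ^+ 2].

Definition dev_mx q (S : {set E}) (Z : 'M[R]_(n1, n2)) :=
  \matrix_(i, j) (dev q (i, j) S * Z i j).

Lemma tangent_dev_mx q S Z : PT (dev_mx q S Z) =
  \sum_(e : E) dev q e S *: PT (Z e.1 e.2 *: delta_mx e.1 e.2).
Proof.
rewrite [dev_mx q S Z]matrix_sum_delta pair_bigA linear_sum /=.
by apply: eq_bigr => -[i j] _ /=; rewrite [dev_mx q S Z i j]mxE !linearZ /= scalerA mulrC.
Qed.

Section Step.
Variables (q K th : R) (j0 : nat).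
Let p := (2 ^ j0)%N.
Hypotheses (q01 : 0 < q <= 1) (K1 : 1 <= K) (th01 : 0 < th <= 2^-1).
Hypothesis rate : (2 * K) ^+ 2 * p.*2%:R * (4 * w ^+ 2) <= th ^+ 2 * q.

Let w0 : 0 < w. Proof. by case/andP: w01. Qed.
Let th0 : 0 < th. Proof. by case/andP: th01. Qed.
Let q0 : 0 < q. Proof. by case/andP: q01. Qed.
Let l0 : 0 < p.*2%:R :> R. Proof. by rewrite ltr0n double_gt0 /p expn_gt0. Qed.

(** The largest-term condition follows from the variance condition [rate], thanks to [th <= 2^-1]
    and [1 <= K]. *)
Let rate1 : 2 * K * p.*2%:R * (2 * w ^+ 2) <= th * q.
Proof.
apply: le_trans (_ : th ^+ 2 * q <= _); last first.
  by rewrite ler_wpM2r ?(ltW q0) // expr2 ler_piMr ?(ltW th0) //; case/andP: th01; lra.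
apply: le_trans rate.
have c0 : 0 <= p.*2%:R * (2 * w ^+ 2) by rewrite mulr_ge0 ?(ltW l0) // mulr_ge0 ?sqr_ge0.
have -> : (2 * K) ^+ 2 * p.*2%:R * (4 * w ^+ 2) = ((2 * K) ^+ 2 * 2) * (p.*2%:R * (2 * w ^+ 2)).
  by ring.
by rewrite -[leLHS]mulrA ler_wpM2r //; move: K1; nra.
Qed.

Section OneStep.
Variables (Z : 'M[R]_(n1, n2)) (b : R).
Hypotheses (b0 : 0 < b) (Zb : norms_le b Z).

Definition good_step (S : {set E}) :=
  norms_le (th * b) (PT (dev_mx q S Z)) /\ op_le (dev_mx q S Z) (th * b / w).

(** By symmetry of the projection, the coefficients of entry [(i, j)] form the projected unit at
    [(i, j)], of squared norm at most [2 * w ^+ 2]. So the entry bound on [Z] suffices for the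
    variance too. *)
Lemma entry_tail i j :
  bern q (fun S => ((th * b * w) ^+ 2 < PT (dev_mx q S Z) i j ^+ 2)%R%:R) <= K^-1 ^+ p.*2.
Proof.
have [Z1 Z2 Z3] := Zb.
pose v (e : E) := col j (row i (PT (Z e.1 e.2 *: delta_mx e.1 e.2))).
pose z (e : E) := `|Z e.1 e.2 * PT (delta_mx e.1 e.2) i j|.
have fE (A : 'M[R]_(n1, n2)) : sqn (col j (row i A)) = A i j ^+ 2.
  by rewrite sqn_col big_ord1 mxE.
rewrite (eq_bern _ (g := fun S => ((th * b * w) ^+ 2 < sqn (\sum_e dev q e S *: v e))%R%:R)); last first.
  move=> S; rewrite -fE tangent_dev_mx !linear_sum /=.
  by under [in RHS]eq_bigr => e _ do rewrite -linearZ -linearZ.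
apply: (vector_tail (z := z)) => //.
- by move=> e; apply: normr_ge0.
- by move=> e; rewrite fE linearZ mxE /z real_normK ?num_real.
- by rewrite !mulr_gt0.
- exact: lt_le_trans K1.
- by rewrite expn_gt0.
- move=> e; rewrite -/p.
  have ze : z e <= b * w * (2 * w ^+ 2).
    by rewrite /z normrM ler_pM ?Z1 // tangent_delta_le.
  have c0 : 0 <= 2 * K * p.*2%:R by rewrite !mulr_ge0 ?(ltW l0) //; move: K1; lra.
  apply: le_trans (ler_wpM2r c0 ze) _.
  have bw : 0 <= b * w by rewrite mulr_ge0 ?ltW.
  have := ler_wpM2l bw rate1; lra.
have zz : \sum_e z e ^+ 2 <= (b * w) ^+ 2 * (2 * w ^+ 2).
  apply: le_trans (_ : \sum_e (b * w) ^+ 2 * PT (delta_mx i j) e.1 e.2 ^+ 2 <= _).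
    apply: ler_sum => e _; rewrite /z normrM exprMn (tangent_delta_sym _ _ e (i, j)) /=.
    rewrite [`|PT _ _ _| ^+ 2]real_normK ?num_real // ler_wpM2r ?sqr_ge0 //.
    by rewrite lerXn2r ?nnegrE ?Z1 // mulr_ge0 ?ltW.
  rewrite -mulr_sumr ler_wpM2l ?sqr_ge0 //.
  apply: le_trans (sqn_tangent_delta UU VV Uw Vw i j).
  by rewrite sqnE pair_bigA.
rewrite -/p; have c0 : 0 <= (2 * K) ^+ 2 * p.*2%:R by rewrite mulr_ge0 ?(ltW l0) ?sqr_ge0.
apply: le_trans (ler_wpM2r c0 zz) _.
have := ler_wpM2l (sqr_ge0 (b * w)) rate.
have := mulr_ge0 (mulr_ge0 (sqr_ge0 (b * w)) (sqr_ge0 w)) c0; lra.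
Qed.

(** Common part of the row and column tails, with [a] the squared size of the projected unit along
    the line, up to a factor 2. The largest term uses the entries of [Z], the variance its line
    norms. *)
Lemma line_tail m (v : E -> 'rV[R]_m) (a : E -> R) :
  (forall e, sqn (v e) <= Z e.1 e.2 ^+ 2 * (2 * a e)) ->
  (forall e, 0 <= a e <= 2 * w ^+ 2) ->
  \sum_e Z e.1 e.2 ^+ 2 * a e <= b ^+ 2 * (2 * w ^+ 2) ->
  bern q (fun S => ((th * b) ^+ 2 < sqn (\sum_e dev q e S *: v e))%R%:R) <= K^-1 ^+ p.*2.
Proof.
have [Z1 Z2 Z3] := Zb => va a0 sa.
pose z (e : E) := `|Z e.1 e.2| * Num.sqrt (2 * a e).
have a2 e : 0 <= 2 * a e by case/andP: (a0 e) => ? _; rewrite mulr_ge0.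
have zE e : z e ^+ 2 = Z e.1 e.2 ^+ 2 * (2 * a e).
  by rewrite exprMn sqr_sqrtr // real_normK ?num_real.
apply: (vector_tail (z := z)) => //.
- by move=> e; rewrite mulr_ge0 ?sqrtr_ge0.
- by move=> e; rewrite zE.
- by rewrite mulr_gt0.
- exact: lt_le_trans K1.
- by rewrite expn_gt0.
- move=> e; rewrite -/p.
  have ze : z e <= b * w * (2 * w).
    rewrite /z ler_pM ?sqrtr_ge0 ?Z1 //.
    rewrite -[leRHS]gtr0_norm ?mulr_gt0 // -sqrtr_sqr ler_wsqrtr //.
    by case/andP: (a0 e) => _ H; rewrite exprMn; lra.
  have c0 : 0 <= 2 * K * p.*2%:R by rewrite !mulr_ge0 ?(ltW l0) //; move: K1; lra.
  apply: le_trans (ler_wpM2r c0 ze) _.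
  have := ler_wpM2l (ltW b0) rate1; lra.
have zz : \sum_e z e ^+ 2 <= b ^+ 2 * (4 * w ^+ 2).
  under eq_bigr => e _ do rewrite zE mulrCA.
  rewrite -mulr_sumr; move: sa; lra.
rewrite -/p; have c0 : 0 <= (2 * K) ^+ 2 * p.*2%:R by rewrite mulr_ge0 ?(ltW l0) ?sqr_ge0.
apply: le_trans (ler_wpM2r c0 zz) _.
by have := ler_wpM2l (sqr_ge0 b) rate; lra.
Qed.

Lemma sqr_le_w (x : R) : `|x| <= w ^+ 2 -> x ^+ 2 <= w ^+ 2.
Proof.
move=> xw; rewrite -(real_normK (num_real x)) expr2.
have w1 : w ^+ 2 <= 1 by rewrite exprn_ile1 ?(ltW w0) //; case/andP: w01.
apply: le_trans (_ : w ^+ 2 * 1 <= _); last by rewrite mulr1.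
by rewrite ler_pM // (le_trans xw).
Qed.

Lemma sum_indicator n (i : 'I_n) (c : R) : \sum_k (i == k)%:R * c = c.
Proof.
rewrite (bigD1 i) //= eqxx mul1r big1 ?addr0 // => k.
by rewrite eq_sym => /negbTE ->; rewrite mul0r.
Qed.

Lemma row_tail i :
  bern q (fun S => ((th * b) ^+ 2 < \sum_j PT (dev_mx q S Z) i j ^+ 2)%R%:R) <= K^-1 ^+ p.*2.
Proof.
have [Z1 Z2 Z3] := Zb.
pose v (e : E) := row i (PT (Z e.1 e.2 *: delta_mx e.1 e.2)).
rewrite (eq_bern _ (g := fun S => ((th * b) ^+ 2 < sqn (\sum_e dev q e S *: v e))%R%:R)); last first.
  move=> S; rewrite -sqn_row tangent_dev_mx !linear_sum /=.
  by under [in RHS]eq_bigr => e _ do rewrite -linearZ.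
pose a (e : E) := (U *m U^T) i e.1 ^+ 2 + (i == e.1)%:R * w ^+ 2.
apply: (line_tail (a := a)).
- move=> e; rewrite /v !linearZ sqnZ ler_wpM2l ?sqr_ge0 //.
  exact: sqn_row_tangent_delta.
- move=> e; rewrite /a addr_ge0 ?sqr_ge0 ?mulr_ge0 ?(ltW w0) //=.
  have := sqr_le_w (proj_le w01 Uw i e.1); have := sqr_ge0 w.
  by case: (i == e.1); rewrite ?mul1r ?mul0r; lra.
have -> : \sum_e Z e.1 e.2 ^+ 2 * a e =
    \sum_i' \sum_j' Z i' j' ^+ 2 * ((U *m U^T) i i' ^+ 2 + (i == i')%:R * w ^+ 2).
  by rewrite pair_bigA.
apply: le_trans (_ : \sum_i' b ^+ 2 * ((U *m U^T) i i' ^+ 2 + (i == i')%:R * w ^+ 2) <= _).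
  apply: ler_sum => i' _; rewrite -mulr_suml ler_wpM2r ?Z2 //.
  by rewrite addr_ge0 ?sqr_ge0 ?mulr_ge0 ?(ltW w0).
rewrite -mulr_sumr ler_wpM2l ?sqr_ge0 // big_split /=.
by rewrite sum_indicator; have := proj_row_le UU Uw i; lra.
Qed.

Lemma col_tail j :
  bern q (fun S => ((th * b) ^+ 2 < \sum_i PT (dev_mx q S Z) i j ^+ 2)%R%:R) <= K^-1 ^+ p.*2.
Proof.
have [Z1 Z2 Z3] := Zb.
pose v (e : E) := row j (PT (Z e.1 e.2 *: delta_mx e.1 e.2))^T.
rewrite (eq_bern _ (g := fun S => ((th * b) ^+ 2 < sqn (\sum_e dev q e S *: v e))%R%:R)); last first.
  move=> S; rewrite -sqn_col -sqn_tr tr_col tangent_dev_mx !linear_sum /=.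
  by under [in RHS]eq_bigr => e _ do rewrite -linearZ -linearZ.
pose a (e : E) := (V *m V^T) j e.2 ^+ 2 + (j == e.2)%:R * w ^+ 2.
apply: (line_tail (a := a)).
- move=> e; rewrite /v !linearZ /= sqnZ ler_wpM2l ?sqr_ge0 //.
  rewrite tangent_tr trmx_delta; exact: sqn_row_tangent_delta.
- move=> e; rewrite /a addr_ge0 ?sqr_ge0 ?mulr_ge0 ?(ltW w0) //=.
  have := sqr_le_w (proj_le w01 Vw j e.2); have := sqr_ge0 w.
  by case: (j == e.2); rewrite ?mul1r ?mul0r; lra.
have -> : \sum_e Z e.1 e.2 ^+ 2 * a e =
    \sum_i' \sum_j' Z i' j' ^+ 2 * ((V *m V^T) j j' ^+ 2 + (j == j')%:R * w ^+ 2).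
  by rewrite pair_bigA.
rewrite exchange_big /=.
apply: le_trans (_ : \sum_j' b ^+ 2 * ((V *m V^T) j j' ^+ 2 + (j == j')%:R * w ^+ 2) <= _).
  apply: ler_sum => i' _; rewrite -mulr_suml ler_wpM2r ?Z3 //.
  by rewrite addr_ge0 ?sqr_ge0 ?mulr_ge0 ?(ltW w0).
rewrite -mulr_sumr ler_wpM2l ?sqr_ge0 // big_split /=.
by rewrite sum_indicator; have := proj_row_le VV Vw j; lra.
Qed.

Lemma spectral_tail :
  bern q (fun S => ((th * b / w) ^+ p.*2 <
    \tr ((dev_mx q S Z *m (dev_mx q S Z)^T) ^+ p))%R%:R) <= n1%:R * K^-1 ^+ p.*2.
Proof.
have [Z1 Z2 Z3] := Zb.
have c0 : 0 <= 2 * K * p.*2%:R by rewrite !mulr_ge0 ?(ltW l0) //; move: K1; lra.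
have c2 : 0 <= (2 * K) ^+ 2 * p.*2%:R by rewrite mulr_ge0 ?(ltW l0) ?sqr_ge0.
have line x : x <= b ^+ 2 -> x * ((2 * K) ^+ 2 * p.*2%:R) <= q * (th * b / w) ^+ 2.
  move=> /(ler_wpM2r c2) xb; apply: le_trans xb _.
  have -> : q * (th * b / w) ^+ 2 = q * th ^+ 2 * b ^+ 2 / w ^+ 2 by field; rewrite gt_eqF.
  rewrite ler_pdivlMr ?exprn_gt0 //.
  have := ler_wpM2l (sqr_ge0 b) rate.
  have := mulr_ge0 (mulr_ge0 (sqr_ge0 b) (sqr_ge0 w)) c2; lra.
apply: matrix_tail => //.
- by rewrite divr_gt0 ?mulr_gt0.
- exact: lt_le_trans K1.
- by rewrite expn_gt0.
- move=> i j; rewrite -/p; apply: le_trans (ler_wpM2r c0 (Z1 i j)) _.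
  rewrite mulrA ler_pdivlMr //; have := ler_wpM2l (ltW b0) rate1.
  have := mulr_ge0 (mulr_ge0 (ltW b0) (sqr_ge0 w)) c0; lra.
- by move=> i; apply: line.
- by move=> j; apply: line.
Qed.

Lemma step_tail : bern q (fun S => `[< ~ good_step S >]%:R) <=
  (n1.+1 ^ 2 * n2.+1)%:R * K^-1 ^+ p.*2.
Proof.
(* [None] stands for a whole line, so the index set enumerates entries, rows, columns and, with two
   [None], the operator norm: [n1.+1 * n2.+1] events, each charged the factor [n1.+1] that only the
   last one needs. *)
pose Q (x : option 'I_n1 * option 'I_n2) (S : {set E}) : bool :=
  match x with
  | (Some i, Some j) => (th * b * w) ^+ 2 < PT (dev_mx q S Z) i j ^+ 2
  | (Some i, None) => (th * b) ^+ 2 < \sum_j PT (dev_mx q S Z) i j ^+ 2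
  | (None, Some j) => (th * b) ^+ 2 < \sum_i PT (dev_mx q S Z) i j ^+ 2
  | (None, None) => (th * b / w) ^+ p.*2 <
      \tr ((dev_mx q S Z *m (dev_mx q S Z)^T) ^+ p)
  end.
have q01' : 0 <= q <= 1 by rewrite ltW //=; case/andP: q01.
apply: le_trans (bern_union_bound q01' (Q := Q) _) _.
  move=> S /asboolP bad; apply: contrapT => /forallNP H; apply: bad; split; first split.
  - move=> i j; have /negP := H (Some i, Some j); rewrite /= -leNgt => Hij.
    rewrite -ler_sqr ?nnegrE ?mulr_ge0 ?(ltW th0) ?(ltW b0) ?(ltW w0) // real_normK ?num_real //.
  - by move=> i; have /negP := H (Some i, None); rewrite /= -leNgt.
  - by move=> j; have /negP := H (None, Some j); rewrite /= -leNgt.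
  have /negP := H (None, None); rewrite /= -leNgt; apply: trace_op_le.
  by rewrite divr_ge0 ?mulr_ge0 ?ltW.
apply: le_trans (_ : \sum_(x : option 'I_n1 * option 'I_n2) n1.+1%:R * K^-1 ^+ p.*2 <= _).
  have k0 : 0 <= K^-1 ^+ p.*2 by rewrite exprn_ge0 ?invr_ge0 // (le_trans _ K1).
  have le1 x : x <= K^-1 ^+ p.*2 -> x <= n1.+1%:R * K^-1 ^+ p.*2.
    by move=> H; apply: le_trans H _; rewrite ler_peMl // ler1n.
  apply: ler_sum => -[[i|] [j|]] _.
  - by apply: le1; apply: entry_tail.
  - by apply: le1; apply: row_tail.
  - by apply: le1; apply: col_tail.
  - by apply: le_trans spectral_tail _; rewrite ler_wpM2r // ler_nat.
rewrite sumr_const card_prod !card_option !card_ord -[leLHS]mulr_natl mulrA.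
by rewrite -natrM; have -> : (n1.+1 * n2.+1 * n1.+1 = n1.+1 ^ 2 * n2.+1)%N by rewrite expnS expn1 mulnAC.
Qed.

End OneStep.

Lemma dev_mxE S Z : dev_mx q S Z = q^-1 *: proj_Omega S Z - Z.
Proof.
apply/matrixP => i j; rewrite !mxE /dev.
by case: ifP => _; rewrite ?mul1r ?mulr0 ?mul0r ?sub0r ?mulN1r // mulrBl mul1r.
Qed.

Fixpoint union_rate k : R :=
  if k is k'.+1 then q + union_rate k' - q * union_rate k' else 0.

Lemma union_rate_bounds k : 0 <= union_rate k <= 1 /\ union_rate k <= k%:R * q.
Proof.
elim: k => [|k [/andP[k0 k1] kq]] /=; first by rewrite mul0r lexx ler01.
have q1 : q <= 1 by case/andP: q01.
have : 0 <= q * union_rate k by rewrite mulr_ge0 ?(ltW q0).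
have : 0 <= (1 - q) * (1 - union_rate k) by rewrite mulr_ge0 ?subr_ge0.
have : 0 <= q * (1 - union_rate k) by rewrite mulr_ge0 ?subr_ge0 ?(ltW q0).
by rewrite -natr1 mulrDl mul1r; move: q0; split; [apply/andP; split|]; lra.
Qed.

(** The bound on [tc Y] sums the step costs [th * b / w], [th ^+ 2 * b / w], and so on; the ratio
    [th <= 2^-1] at most doubles the first, uniformly in [k]. *)
Definition golfed k b (Z : 'M[R]_(n1, n2)) (Omega : {set E}) :=
  exists Y, [/\ proj_Omega Omega Y = Y, norms_le (th ^+ k * b) (Z - PT Y) &
                op_le (tc Y) (2 * th * b / w)].

Lemma norms_leN b Z : norms_le b Z -> norms_le b (- Z).
Proof.
case=> Z1 Z2 Z3; split=> [i j|i|j]; first by rewrite mxE normrN.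
  by under eq_bigr => j _ do rewrite mxE sqrrN.
by under eq_bigr => i _ do rewrite mxE sqrrN.
Qed.

Lemma proj_Omega_sub (S T : {set E}) (M : 'M[R]_(n1, n2)) : S \subset T ->
  proj_Omega S M = M -> proj_Omega T M = M.
Proof.
move=> /fintype.subsetP ST SM; apply/matrixP => i j; rewrite mxE.
case: ifPn => // ijT; rewrite -SM mxE ifN //.
by apply: contraNN ijT; apply: ST.
Qed.

Lemma op_le_mono (A : 'M[R]_(n1, n2)) a a' : 0 <= a -> a <= a' -> op_le A a -> op_le A a'.
Proof.
move=> a0 aa Aa y; apply: le_trans (Aa y) _; rewrite ler_wpM2r ?sqn_ge0 //.
by rewrite lerXn2r ?nnegrE // (le_trans a0).
Qed.

Lemma golfed_step k b Z (S T : {set E}) : 0 < b -> PT Z = Z ->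
  good_step Z b S -> golfed k (th * b) (- PT (dev_mx q S Z)) T ->
  golfed k.+1 b Z (S :|: T).
Proof.
move=> b0 PZ [_ opS] [Y [TY nY opY]].
have ws : 0 <= th * b / w by rewrite divr_ge0 ?mulr_ge0 ?(ltW th0) ?(ltW b0) ?(ltW w0).
exists (q^-1 *: proj_Omega S Z + Y); split.
- apply/matrixP => i j; rewrite mxE inE; case: ifPn => // /norP[/negbTE iS iT].
  rewrite !mxE iS mulr0 add0r -TY mxE; by rewrite (negbTE iT).
- have -> : Z - PT (q^-1 *: proj_Omega S Z + Y) = - PT (dev_mx q S Z) - PT Y.
    have TD A B : PT (A + B) = PT A + PT B by apply: linearD.
    have TN A : PT (- A) = - PT A by apply: linearN.
    rewrite dev_mxE !TD TN PZ; move: (PT (_ *: _)) (PT Y) => A B.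
    by rewrite !opprD opprK addrA [- A + Z]addrC.
  by rewrite exprSr -mulrA.
- have -> : tc (q^-1 *: proj_Omega S Z + Y) = tc (dev_mx q S Z) + tc Y.
    have TD A B : tc (A + B) = tc A + tc B by apply: linearD.
    rewrite dev_mxE !TD (_ : tc (- Z) = 0) ?addr0 // linearN /=; apply/eqP.
    rewrite oppr_eq0; apply/eqP.
    by rewrite -PZ tc_tangent.
  have H : th * b / w + 2 * th * (th * b) / w <= 2 * th * b / w.
    have -> : 2 * th * (th * b) / w = 2 * th * (th * b / w) by rewrite !mulrA.
    have -> : 2 * th * b / w = 2 * (th * b / w) by rewrite !mulrA.
    case/andP: th01 => _ th1; have := ler_wpM2r ws th1; lra.
  have ws2 : 0 <= 2 * th * (th * b) / w.
    by rewrite divr_ge0 ?(ltW w0) // !mulr_ge0 ?(ltW th0) ?(ltW b0).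
  apply: op_le_mono H _; first by rewrite addr_ge0.
  by apply: op_leD => //; apply: op_le_tc.
Qed.

(** Induction on [k], splitting off the first batch [S]. Once [S] is fixed and good, the new
    residual [- PT (dev_mx q S Z)] is deterministic for the other batches and lies in the tangent
    space, so the induction hypothesis applies to it with [th * b]. *)
Lemma golfing k b Z : 0 < b -> PT Z = Z -> norms_le b Z ->
  bern (union_rate k) (fun Omega => `[< ~ golfed k b Z Omega >]%:R) <=
  k%:R * ((n1.+1 ^ 2 * n2.+1)%:R * K^-1 ^+ p.*2).
Proof.
set dl := (_ * K^-1 ^+ _).
have q01' : 0 <= q <= 1 by rewrite ltW //=; case/andP: q01.
elim: k b Z => [|k IH] b Z b0 PZ Zb.
  rewrite mul0r (eq_bern _ (g := fun=> 0)) ?bern_cst // => S.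
  rewrite asboolF //; apply; exists 0; split.
  - by apply/matrixP => i j; rewrite !mxE if_same.
  - by rewrite linear0 subr0 expr0 mul1r.
  - by rewrite linear0 => y; rewrite mul0mx sqn0 mulr_ge0 ?sqn_ge0 ?sqr_ge0.
have [pk01 _] := union_rate_bounds k.
rewrite /= -bern_setU.
apply: le_trans (_ : bern q (fun S => `[< ~ good_step Z b S >]%:R + k%:R * dl) <= _); last first.
  rewrite bernD bern_cst -natr1 mulrDl mul1r addrC lerD2l.
  exact: step_tail.
apply: le_bern => // S; case: (asboolP (~ good_step Z b S)) => [_|/contrapT good] /=.
  rewrite -[leLHS]addr0; apply: lerD.
    rewrite -[leRHS](bern_cst E (union_rate k)); apply: le_bern => // T.
    by case: asboolP.
  by rewrite mulr_ge0 // mulr_ge0 // exprn_ge0 // invr_ge0 (le_trans _ K1).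
rewrite add0r; apply: le_trans (IH (th * b) (- PT (dev_mx q S Z)) _ _ _).
- apply: le_bern => // T; rewrite ler_nat; case: asboolP => // H1.
  by case: asboolP => // /contrapT H2; case: H1; apply: golfed_step.
- by rewrite mulr_gt0.
- by rewrite linearN /= tangent_idem.
- by apply: norms_leN; case: good.
Qed.

End Step.
End Golfing.

(** * Uniform sampling and exact certificates *)

Section UniformTransfer.
Variables (R : realType) (E : finType).
Implicit Types (S T : {set E}) (F : pred {set E}).

Definition level (F : {set E} -> R) k : R := \sum_(S : {set E} | #|S| == k) F S.

(** Double counting of the pairs of a [k]-set and a point outside it. It compares consecutive
    levels, so that the average of a nonincreasing function over [k]-sets is nonincreasing in
    [k]. *)
Lemma sum_remove_point (G : {set E} -> R) k :
  \sum_(T : {set E} | #|T| == k.+1) \sum_(e in T) G (T :\ e) =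
  \sum_(S : {set E} | #|S| == k) \sum_(e | e \notin S) G S.
Proof.
rewrite (exchange_big_dep xpredT) //= [RHS](exchange_big_dep xpredT) //=.
apply: eq_bigr => e _.
rewrite (reindex_onto (fun S : {set E} => e |: S) (fun T => T :\ e)) /=; last first.
  by move=> T /andP[_ eT]; rewrite finset.setD1K.
apply: eq_big => [S|S /andP[_ /eqP -> //]].
rewrite finset.setU11 andbT; have [eS|eS] := boolP (e \in S).
  rewrite andbF; apply/negbTE; apply: contraTN eS => /andP[_ /eqP <-].
  by rewrite !inE eqxx.
by rewrite cardsU1 eS add1n eqSS finset.setU1K // eqxx !andbT.
Qed.

Lemma level_succ (F : {set E} -> R) k :
  (forall S T, S \subset T -> F T <= F S) ->
  k.+1%:R * level F k.+1 <= (#|E| - k)%:R * level F k.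
Proof.
move=> Fmon; rewrite !mulr_sumr.
apply: le_trans (_ : \sum_(T : {set E} | #|T| == k.+1) \sum_(e in T) F (T :\ e) <= _).
  apply: ler_sum => T /eqP Tk; rewrite -Tk mulr_natl -sumr_const.
  by apply: ler_sum => e _; apply: Fmon; apply: subD1set.
rewrite sum_remove_point; apply: ler_sum => S /eqP Sk.
rewrite sumr_const mulr_natl (_ : #|_| = (#|E| - k)%N) //.
by rewrite -Sk -(cardC (mem S)) addKn; apply: eq_card => e; rewrite !inE.
Qed.

Lemma level1_succ k :
  k.+1%:R * level (fun=> 1) k.+1 = (#|E| - k)%:R * level (fun=> 1) k.
Proof.
have := @sum_remove_point (fun=> 1) k; rewrite !mulr_sumr => H.
transitivity (\sum_(T : {set E} | #|T| == k.+1) \sum_(e in T) (1 : R)).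
  by apply: eq_bigr => T /eqP Tk; rewrite sumr_const Tk mulr1.
rewrite H; apply: eq_bigr => S /eqP Sk; rewrite sumr_const mulr1; congr _%:R.
by rewrite -Sk -(cardC (mem S)) addKn; apply: eq_card => e; rewrite !inE.
Qed.

Lemma level1_gt0 k : (k <= #|E|)%N -> 0 < level (fun=> 1) k.
Proof.
elim: k => [|k IH] kE.
  rewrite /level (bigD1 finset.set0) ?cards0 //= ltr_pwDl // sumr_ge0 //.
have : 0 < k.+1%:R * level (fun=> 1) k.+1.
  by rewrite level1_succ mulr_gt0 ?IH ?ltr0n ?subn_gt0 // ltnW.
by rewrite pmulr_rgt0 ?ltr0n.
Qed.

Lemma level_density_noninc (F : {set E} -> R) k m :
  (forall S T, S \subset T -> F T <= F S) -> (k <= m)%N -> (m <= #|E|)%N ->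
  level F m / level (fun=> 1) m * level (fun=> 1) k <= level F k.
Proof.
move=> Fmon; elim: m => [|m IH]; rewrite ?leqn0.
  by move=> /eqP -> _; rewrite divfK ?gt_eqF ?level1_gt0.
rewrite leq_eqVlt => /predU1P[-> mE|km mE]; first by rewrite divfK ?gt_eqF ?level1_gt0.
apply: le_trans (IH _ (ltnW mE)) => //.
have l1 := level1_gt0 mE; have l0 := level1_gt0 (ltnW mE).
rewrite ltnS in km; have lk := level1_gt0 (leq_trans km (ltnW mE)).
rewrite ler_wpM2r ?(ltW lk) //.
rewrite ler_pdivrMr // mulrAC ler_pdivlMr //.
have m0 : 0 < m.+1%:R :> R by rewrite ltr0n.
rewrite -(ler_pM2l m0) [leRHS]mulrCA level1_succ [leLHS]mulrA [leRHS]mulrCA [leRHS]mulrA.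
by rewrite ler_wpM2r ?(ltW l0) // level_succ.
Qed.

(* If [P #|E| <= m / 2] then by Markov a Bernoulli([P]) set has at most [m]
   elements with probability at least 1/2, and smaller sets fail more often. *)
Lemma uniform_le_bern F (m : nat) (P : R) : (forall S T, S \subset T -> F T -> F S) ->
  (0 < m <= #|E|)%N -> 0 <= P <= 1 -> P * #|E|%:R <= m%:R / 2 ->
  level (fun S => (F S)%:R) m / level (fun=> 1) m <= 2 * bern P (fun S => (F S)%:R).
Proof.
move=> Fmon /andP[m0 mE] P01 Pm; set ph := _ / _.
have F0 S T : S \subset T -> (F T)%:R <= (F S)%:R :> R.
  by move=> ST; rewrite ler_nat; case: (F T) (Fmon _ _ ST) => // ->.
have ph0 : 0 <= ph by rewrite divr_ge0 // sumr_ge0.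
(* A Bernoulli set conditioned on its cardinality is uniform. This writes the part with at most [m]
   elements as a mixture of levels, to which [level_density_noninc] applies term by term. *)
have levels (G : {set E} -> R) :
    bern P (fun S => (#|S| <= m)%:R * G S) =
    \sum_(k < m.+1) P ^+ k * (1 - P) ^+ (#|E| - k) * level G k.
  rewrite /bern (eq_bigr (fun S => if (#|S| <= m)%N then bweight P S * G S else 0)); last first.
    by move=> S _; case: ifP => _; rewrite ?mul1r // mul0r mulr0.
  rewrite -big_mkcond /= (partition_big (fun S => inord #|S|) (xpredT : pred 'I_m.+1)) //=.
  apply: eq_bigr => k _; rewrite mulr_sumr; apply: eq_big => [S|S /andP[Sm]].
    rewrite -val_eqE /=; have [Sm|mS] := leqP #|S| m; first by rewrite inordK.
    by apply/esym/negbTE; rewrite neq_ltn (leq_ltn_trans _ mS) ?orbT // -ltnS.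
  move=> /eqP <-; rewrite inordK // bweight_card; congr (_ * _ ^+ _ * _).
  by rewrite (cardsCs (~: S)) finset.setCK.
apply: le_trans (_ : 2 * bern P (fun S => (#|S| <= m)%:R * (F S)%:R) <= _); last first.
  rewrite ler_wpM2l //; apply: le_bern => // S.
  by case: (#|S| <= m)%N; rewrite ?mul1r // mul0r.
rewrite levels.
apply: le_trans (_ : 2 * (ph * bern P (fun S => (#|S| <= m)%:R * 1)) <= _); last first.
  rewrite ler_wpM2l // levels mulr_sumr; apply: ler_sum => k _.
  rewrite mulrCA ler_wpM2l //; last first.
    by apply: level_density_noninc => //; rewrite -ltnS.
  case/andP: P01 => ? ?; by rewrite mulr_ge0 ?exprn_ge0 ?subr_ge0.
suff : 2^-1 <= bern P (fun S => (#|S| <= m)%:R * 1).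
  by move=> H; have := ler_wpM2l ph0 H; lra.
have tail : bern P (fun S => (m < #|S|)%N%:R) <= 2^-1.
  apply: le_trans (bern_markov (c := m%:R) P01 _ (f := fun S => #|S|%:R) _ _) _ => //.
  - by rewrite ltr0n.
  - by move=> S mS; rewrite ler_nat; exact: ltnW.
  by rewrite bern_card ler_pdivrMr ?ltr0n // [leRHS]mulrC.
have := bern_cst E P 1.
rewrite (eq_bern _ (g := fun S => (#|S| <= m)%:R * 1 + (m < #|S|)%N%:R)); last first.
  by move=> S; case: leqP => _; rewrite ?mul0r ?mulr1 ?addr0 ?add0r.
by rewrite bernD; move: tail; lra.
Qed.

End UniformTransfer.

(** * Exact correction of the last residual *)

Section Correction.
Variables (R : realType) (n1 n2 : nat).

Lemma linear_inj_surj (f : {linear 'M[R]_(n1, n2) -> 'M[R]_(n1, n2)}) :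
  (forall M, f M = 0 -> M = 0) -> forall N, exists M, f M = N.
Proof.
move=> f0 N.
have fu : lin_mx f \in unitmx.
  rewrite -row_free_unit; apply: inj_row_free => v vf.
  have := mul_vec_lin f (vec_mx v).
  rewrite vec_mxK vf => /esym/eqP; rewrite mxvec_eq0 => /eqP/f0 v0.
  by rewrite -[v]vec_mxK v0 linear0.
exists (vec_mx (mxvec N *m invmx (lin_mx f))).
apply: (can_inj mxvecK); rewrite -mul_vec_lin vec_mxK.
by rewrite mulmxKV.
Qed.

Variable G : 'I_n1 -> 'I_n2 -> 'M[R]_(n1, n2).

Definition residual_map (M : 'M[R]_(n1, n2)) := M - \sum_i \sum_j M i j *: G i j.

Lemma residual_map_is_linear : linear residual_map.
Proof.
move=> a M N; rewrite /residual_map scalerBr scaler_sumr addrACA -opprD -big_split /=.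
congr (_ - _); apply: eq_bigr => i _; rewrite scaler_sumr -big_split /=.
by apply: eq_bigr => j _; rewrite !mxE scalerDl scalerA.
Qed.

HB.instance Definition _ := GRing.isLinear.Build R 'M[R]_(n1, n2) 'M[R]_(n1, n2) *:%R
  residual_map residual_map_is_linear.

Definition l1norm (M : 'M[R]_(n1, n2)) := \sum_i \sum_j `|M i j|.

Lemma l1norm_ge0 M : 0 <= l1norm M.
Proof. by rewrite !sumr_ge0 // => i _; rewrite sumr_ge0. Qed.

Lemma l1norm_eq0 M : l1norm M <= 0 -> M = 0.
Proof.
move=> M0; have /eqP := le_anti (introT andP (conj M0 (l1norm_ge0 M))).
rewrite /l1norm pair_bigA /= psumr_eq0 // => /allP H.
by apply/matrixP => i j; have := H (i, j) (mem_index_enum _); rewrite normr_eq0 mxE => /eqP.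
Qed.

Lemma l1normD M N : l1norm (M + N) <= l1norm M + l1norm N.
Proof.
rewrite -big_split; apply: ler_sum => i _; rewrite -big_split; apply: ler_sum => j _.
by rewrite mxE ler_normD.
Qed.

Lemma l1norm_le (M : 'M[R]_(n1, n2)) (e : R) : (forall i j, `|M i j| <= e) ->
  l1norm M <= (n1 * n2)%:R * e.
Proof.
move=> Me; apply: le_trans (_ : \sum_(i < n1) \sum_(j < n2) e <= _).
  by apply: ler_sum => i _; apply: ler_sum => j _.
by rewrite !sumr_const !card_ord -mulrnA mulnC mulr_natl.
Qed.

Lemma l1norm_comb (M : 'M[R]_(n1, n2)) :
  (forall i j, l1norm (G i j) <= 2^-1) ->
  l1norm (\sum_i \sum_j M i j *: G i j) <= 2^-1 * l1norm M.
Proof.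
move=> Gh; have l1Z a N : l1norm (a *: N) = `|a| * l1norm N.
  rewrite mulr_sumr; apply: eq_bigr => i _; rewrite mulr_sumr.
  by apply: eq_bigr => j _; rewrite mxE normrM.
rewrite mulr_sumr; elim/big_ind2: _ => [|A a B b Aa Bb|i _].
- by rewrite /l1norm big1 // => i _; rewrite big1 // => j _; rewrite mxE normr0.
- by apply: le_trans (l1normD _ _) (lerD Aa Bb).
rewrite mulr_sumr; elim/big_ind2: _ => [|A a B b Aa Bb|j _].
- by rewrite /l1norm big1 // => k _; rewrite big1 // => j _; rewrite mxE normr0.
- by apply: le_trans (l1normD _ _) (lerD Aa Bb).
by rewrite l1Z mulrC ler_wpM2r.
Qed.

(** The subtracted map halves the l1 norm at least, so [residual_map] shrinks it by at most a factor
    2. It is therefore injective, hence surjective in finite dimension; no Neumann series is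
    needed. *)
Lemma residual_map_surj N : (forall i j, l1norm (G i j) <= 2^-1) ->
  exists M, residual_map M = N /\ l1norm M <= 2 * l1norm N.
Proof.
move=> Gh.
have bound M : l1norm M <= 2 * l1norm (residual_map M).
  have : M = residual_map M + \sum_i \sum_j M i j *: G i j by rewrite subrK.
  move/(congr1 l1norm) => H; have := l1normD (residual_map M) (\sum_i \sum_j M i j *: G i j).
  rewrite -H; have := l1norm_comb M Gh; lra.
have [|M MN] := @linear_inj_surj residual_map _ N.
  move=> M M0; apply: l1norm_eq0; have := bound M.
  rewrite M0 => /le_trans; apply; rewrite /l1norm big1 ?mulr0 // => i _.
  by rewrite big1 // => j _; rewrite mxE normr0.
by exists M; rewrite MN; split=> //; rewrite -MN.
Qed.

End Correction.

Section Assembly.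
Variables (R : realType) (n1 n2 r : nat).
Variables (U : 'M[R]_(n1, r)) (s : 'rV[R]_r) (V : 'M[R]_(n2, r)).
Hypotheses (UU : U^T *m U = 1%:M) (VV : V^T *m V = 1%:M).
Hypothesis s0 : forall i, 0 < s 0 i.
Let X : 'M[R]_(n1, n2) := U *m diag_mx s *m V^T.
Notation PT := (tangent U V).
Notation tc := (tangent_compl U V).

Definition certified (Omega : {set 'I_n1 * 'I_n2}) :=
  (exists Y t, [/\ proj_Omega Omega Y = Y, PT Y = X, op_le (tc Y) t, 0 <= t &
                   forall i, t < s 0 i]) /\
  (forall D, proj_Omega Omega D = 0 -> tc D = 0 -> D = 0).

Lemma certified_sub (S T : {set 'I_n1 * 'I_n2}) : S \subset T ->
  certified S -> certified T.
Proof.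
move=> ST [[Y [t [SY PY Yt t0 ts]]] inj]; split.
  by exists Y, t; split=> //; apply: proj_Omega_sub SY.
move=> D TD; apply: inj; apply/matrixP => i j; rewrite !mxE.
case: ifPn => // /(fintype.subsetP ST) ijT.
by have := congr1 (fun M : 'M[R]_(n1, n2) => M i j) TD; rewrite !mxE ijT.
Qed.

Lemma certified_recovery (Omega : {set 'I_n1 * 'I_n2}) : certified Omega ->
  argmin (rstar r) (feasible Omega X) = [set X]%classic /\
  strong_duality r (indicator R (feasible Omega X)).
Proof.
move=> [[Y [t [SY PY Yt t0 ts]]] inj].
have XY : X + tc Y = Y by rewrite -PY /tangent subrK.
have XYO : proj_Omega Omega (X + tc Y) = X + tc Y by rewrite XY.
have UW := UtC V UU Y; have WV := tCV U VV Y.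
by split; [apply: argmin_rstar ts XYO inj | apply: strong_duality_feasible ts XYO].
Qed.

Variables (w th s1 : R) (k : nat).
Hypotheses (w01 : 0 < w <= 1) (th0 : 0 <= th) (s1_gt0 : 0 < s1).
Hypothesis small : (n1 * n2)%:R * (4 * th ^+ k * w) <= 1.
Hypothesis th_s : forall i, 4 * th * s1 < s 0 i.

Lemma op_leZn m n (A : 'M[R]_(m, n)) a c : op_le A a -> op_le (c *: A) (`|c| * a).
Proof.
by move=> /op_leZ -/(_ c) H y; apply: le_trans (H y) _; rewrite !exprMn real_normK ?num_real.
Qed.

Lemma op_le_comb (M : 'M[R]_(n1, n2)) (Y : 'I_n1 -> 'I_n2 -> 'M[R]_(n1, n2)) a :
  0 <= a -> (forall i j, op_le (Y i j) a) ->
  op_le (\sum_i \sum_j M i j *: Y i j) (l1norm M * a).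
Proof.
move=> a0 Ya; have op0 : op_le (0 : 'M[R]_(n1, n2)) 0.
  by move=> y; rewrite mul0mx sqn0 expr0n mul0r.
suff [H _] : op_le (\sum_i \sum_j M i j *: Y i j) (l1norm M * a) /\ 0 <= l1norm M * a by [].
rewrite /l1norm mulr_suml.
apply: (big_ind2 (fun A x => op_le A x /\ 0 <= x)) => [//|A x B y [Ax x0] [By y0]|i _].
  by split; rewrite ?addr_ge0 //; apply: op_leD.
rewrite mulr_suml.
apply: (big_ind2 (fun A x => op_le A x /\ 0 <= x)) => [//|A x B y [Ax x0] [By y0]|j _].
  by split; rewrite ?addr_ge0 //; apply: op_leD.
by split; rewrite ?mulr_ge0 //; apply: op_leZn.
Qed.

Lemma tangent_delta_norms_le i j :
  (forall i, sqn (row i U) <= w ^+ 2) -> (forall j, sqn (row j V) <= w ^+ 2) ->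
  norms_le w 2 (PT (delta_mx i j)).
Proof.
move=> Uw Vw; have [w0 w1] := andP w01.
have w2 : w ^+ 2 <= w by rewrite expr2 ler_piMl ?(ltW w0).
have sq4 : sqn (PT (delta_mx i j)) <= 2 ^+ 2.
  by apply: le_trans (sqn_tangent_delta UU VV Uw Vw i j) _; lra.
split=> [a b|a|b].
- apply: le_trans (tangent_delta_le UU VV Uw Vw i j a b) _; lra.
- apply: le_trans sq4; rewrite sqnE (bigD1 a) //= lerDl sumr_ge0 // => c _.
  by rewrite sumr_ge0 // => d _; rewrite sqr_ge0.
- apply: le_trans sq4; rewrite sqnE exchange_big (bigD1 b) //= lerDl sumr_ge0 // => c _.
  by rewrite sumr_ge0 // => d _; rewrite sqr_ge0.
Qed.

(** The supported matrices [Y i j] nearly reproduce the projected units, with errors [G i j]. By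
    duality this gives injectivity; by inverting [residual_map], a combination [W] of the [Y i j]
    satisfies [PT W = X - PT Y0]. *)
Lemma golfed_certified (Omega : {set 'I_n1 * 'I_n2}) :
  golfed U V w th k (s1 * w) X Omega ->
  (forall i j, golfed U V w th k 2 (PT (delta_mx i j)) Omega) ->
  certified Omega.
Proof.
move=> [Y0 [OY0 [nY0 _ _] opY0]] gd; have [w0 w1] := andP w01.
have e0 : 0 <= th ^+ k by rewrite exprn_ge0.
have /choice[Yp Yp_] : forall x : 'I_n1 * 'I_n2, exists Y, [/\ proj_Omega Omega Y = Y,
    norms_le w (th ^+ k * 2) (PT (delta_mx x.1 x.2) - PT Y) & op_le (tc Y) (2 * th * 2 / w)].
  by move=> [i j]; have [Y YP] := gd i j; exists Y.
pose Y i j := Yp (i, j).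
have YP i j := Yp_ (i, j).
have supp_inner (M N : 'M[R]_(n1, n2)) : proj_Omega Omega M = M -> proj_Omega Omega N = 0 -> inner M N = 0.
  by move=> <- N0; rewrite -inner_proj_Omega N0 inner0r.
pose G (i : 'I_n1) (j : 'I_n2) : 'M[R]_(n1, n2) := PT (delta_mx i j) - PT (Y i j).
have Ge i j a b : `|G i j a b| <= 2 * th ^+ k * w.
  by have [_ [H _ _] _] := YP i j; apply: le_trans (H a b) _; lra.
have Gh i j : l1norm (G i j) <= 2^-1.
  by apply: le_trans (l1norm_le (Ge i j)) _; move: small; lra.
split; last first.
  move=> D OD tD; have PD : PT D = D by rewrite /tangent tD subr0.
  (* The entry [D i j] is the pairing of [D] with the projected unit, and [Y i j] pairs to zero with
     a [D] that vanishes on [Omega]; only [G i j] remains. Summing over entries gives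
     [l1norm D <= 2^-1 * l1norm D]. *)
  have Dij i j : `|D i j| <= 2 * th ^+ k * w * l1norm D.
    have -> : D i j = inner (G i j) D.
      rewrite innerBl !inner_tangent_sym PD inner_delta (supp_inner (Y i j)) ?subr0 //.
      by have [] := YP i j.
    rewrite innerE mulr_sumr; apply: le_trans (ler_norm_sum _ _ _) _.
    apply: ler_sum => a _; rewrite mulr_sumr; apply: le_trans (ler_norm_sum _ _ _) _.
    by apply: ler_sum => b _; rewrite normrM ler_wpM2r.
  apply: l1norm_eq0; have := l1norm_le Dij; rewrite mulrA.
  have := ler_wpM2r (l1norm_ge0 D) small; lra.
have PX : PT X = X by apply: tangent_svd.
have TD A B : PT (A + B) = PT A + PT B by apply: linearD.
have TN A : PT (- A) = - PT A by apply: linearN.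
have [M [MN MN1]] := residual_map_surj (X - PT Y0) Gh.
pose W := \sum_i \sum_j M i j *: Y i j.
have PW : PT W = \sum_i \sum_j M i j *: PT (Y i j).
  rewrite linear_sum; apply: eq_bigr => i _; rewrite linear_sum.
  by apply: eq_bigr => j _; rewrite linearZ.
have PMd : PT M = \sum_i \sum_j M i j *: PT (delta_mx i j).
  rewrite {1}[M]matrix_sum_delta linear_sum; apply: eq_bigr => i _; rewrite linear_sum.
  by apply: eq_bigr => j _; rewrite linearZ.
have GE : \sum_i \sum_j M i j *: G i j = PT M - PT W.
  rewrite PW PMd -sumrB; apply: eq_bigr => i _; rewrite -sumrB.
  by apply: eq_bigr => j _; rewrite scalerBr.
(* [residual_map G M] is tangent because [X - PT Y0] is, and it differs from [M] by a tangent
   matrix. *)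
have PM : PT M = M.
  have : PT (residual_map G M) = residual_map G M.
    by rewrite MN TD TN PX tangent_idem.
  rewrite /residual_map GE !TD !TN TD TN !tangent_idem //.
  by move/addIr.
have PY : PT (Y0 + W) = X.
  have : PT W = X - PT Y0 by rewrite -MN /residual_map GE PM opprB addrC subrK.
  by rewrite TD => ->; rewrite addrC subrK.
(* The golfing part costs [2 * th * s1]. By [small], [l1norm M <= 2^-1 * s1 * w], so the correction
   costs at most [2 * th * s1] as well, and [th_s] leaves room for both. *)
exists (Y0 + W), (2 * th * (s1 * w) / w + l1norm M * (2 * th * 2 / w)); split=> //.
- apply/matrixP => i j; rewrite mxE; case: ifPn => // ijO.
  have Y00 : Y0 i j = 0 by rewrite -OY0 mxE (negbTE ijO).
  rewrite mxE Y00 add0r summxE big1 // => a _; rewrite summxE big1 // => b _.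
  by have [YO _ _] := YP a b; rewrite mxE /Y -YO mxE (negbTE ijO) mulr0.
- have -> : tc (Y0 + W) = tc Y0 + tc W by apply: linearD.
  have c0 : 0 <= 2 * th * 2 / w by rewrite divr_ge0 ?mulr_ge0 ?(ltW w0).
  apply: op_leD => //.
  + by rewrite divr_ge0 ?mulr_ge0 ?(ltW w0) ?(ltW s1_gt0).
  + by rewrite mulr_ge0 ?l1norm_ge0.
  have -> : tc W = \sum_i \sum_j M i j *: tc (Y i j).
    rewrite linear_sum; apply: eq_bigr => i _; rewrite linear_sum.
    by apply: eq_bigr => j _; rewrite linearZ.
  by apply: op_le_comb => // i j; have [] := YP i j.
- rewrite addr_ge0 ?mulr_ge0 ?l1norm_ge0 ?invr_ge0 ?(ltW w0) ?(ltW s1_gt0) //.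
- move=> i; apply: le_lt_trans (th_s i).
  have N1 : l1norm (X - PT Y0) <= (n1 * n2)%:R * (th ^+ k * (s1 * w) * w) by apply: l1norm_le.
  have -> : 2 * th * (s1 * w) / w = 2 * th * s1 by field; rewrite gt_eqF.
  have -> : l1norm M * (2 * th * 2 / w) = 4 * th * (l1norm M / w) by field; rewrite gt_eqF.
  have Mw : l1norm M / w <= 2^-1 * s1.
    rewrite ler_pdivrMr //; apply: le_trans MN1 _.
    have := ler_wpM2r (mulr_ge0 (ltW s1_gt0) (ltW w0)) small; move: N1; lra.
  have := ler_wpM2l th0 Mw; lra.
Qed.

End Assembly.

(** * Main theorem *)

Section Probability.
Variables (R : realType) (n1 n2 r : nat).
Variables (U : 'M[R]_(n1, r)) (s : 'rV[R]_r) (V : 'M[R]_(n2, r)).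
Hypotheses (UU : U^T *m U = 1%:M) (VV : V^T *m V = 1%:M).
Hypothesis s0 : forall i, 0 < s 0 i.
Let X : 'M[R]_(n1, n2) := U *m diag_mx s *m V^T.
Variables (w q K th s1 : R) (j0 k m : nat).
Hypothesis (w01 : 0 < w <= 1).
Hypothesis (Uw : forall i, sqn (row i U) <= w ^+ 2).
Hypothesis (Vw : forall j, sqn (row j V) <= w ^+ 2).
Hypotheses (q01 : 0 < q <= 1) (K1 : 1 <= K) (th01 : 0 < th <= 2^-1).
Hypothesis rate : (2 * K) ^+ 2 * (2 ^ j0).*2%:R * (4 * w ^+ 2) <= th ^+ 2 * q.
Hypotheses (s1_gt0 : 0 < s1) (s_le : forall i, s 0 i <= s1).
Hypothesis small : (n1 * n2)%:R * (4 * th ^+ k * w) <= 1.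
Hypothesis th_s : forall i, 4 * th * s1 < s 0 i.
Let dl := (n1.+1 ^ 2 * n2.+1)%:R * K^-1 ^+ (2 ^ j0).*2.

(** An entry of [X] involves an incoherent row on both sides, hence [w ^+ 2]; the norm of a line
    involves only one. *)
Lemma svd_norms_le : norms_le w (s1 * w) X.
Proof.
have w0 : 0 <= w by apply: ltW; case/andP: w01.
have s1w : 0 <= s1 * w by rewrite mulr_ge0 ?(ltW s1_gt0).
have rowD n (A : 'M[R]_(n, r)) i : sqn (row i A) <= w ^+ 2 ->
    sqn (row i A *m diag_mx s) <= (s1 * w) ^+ 2.
  move=> Aw; rewrite exprMn; apply: le_trans (_ : s1 ^+ 2 * sqn (row i A) <= _); last first.
    by rewrite ler_wpM2l ?sqr_ge0.
  rewrite !sqnE !big_ord1 mulr_sumr; apply: ler_sum => l _.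
  rewrite mul_mx_diag mxE exprMn mulrC ler_wpM2r ?sqr_ge0 //.
  by rewrite lerXn2r ?nnegrE ?s_le ?(ltW (s0 _)) ?(ltW s1_gt0).
split=> [i j|i|j].
- have -> : X i j = inner (row i U *m diag_mx s) (row j V).
    rewrite innerE big_ord1 /X mxE; apply: eq_bigr => l _.
    by rewrite !mul_mx_diag !mxE.
  by apply: inner_abs_le => //; apply: rowD.
- rewrite -sqn_row /X !row_mul -sqn_tr trmx_mul trmxK sqn_orthl // sqn_tr.
  exact: rowD.
- rewrite -sqn_col -sqn_tr tr_col /X !trmx_mul trmxK tr_diag_mx mulmxA.
  by rewrite !row_mul -sqn_tr trmx_mul trmxK sqn_orthl // sqn_tr; apply: rowD.
Qed.

Lemma certified_bern :
  bern (union_rate q k) (fun Omega => `[< ~ certified U s V Omega >]%:R) <=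
  (n1 * n2).+1%:R * (k%:R * dl).
Proof.
have [P01 _] := union_rate_bounds q01 k.
pose Q (x : option ('I_n1 * 'I_n2)) (Omega : {set 'I_n1 * 'I_n2}) : bool :=
  if x is Some (i, j) then `[< ~ golfed U V w th k 2 (tangent U V (delta_mx i j)) Omega >]
  else `[< ~ golfed U V w th k (s1 * w) X Omega >].
apply: le_trans (bern_union_bound P01 (Q := Q) _) _.
  move=> Omega /asboolP nc; apply: contrapT => /forallNP H; apply: nc.
  have th0 : 0 <= th by apply: ltW; case/andP: th01.
  apply: (golfed_certified UU VV w01 th0 s1_gt0 small th_s).
    by have /negP/asboolPn/contrapT := H None.
  by move=> i j; have /negP/asboolPn/contrapT := H (Some (i, j)).
apply: le_trans (_ : \sum_(x : option ('I_n1 * 'I_n2)) k%:R * dl <= _); last first.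
  by rewrite sumr_const card_option card_prod !card_ord -[leLHS]mulr_natl.
have w0 : 0 < w by case/andP: w01.
apply: ler_sum => -[[i j]|] _ /=.
  apply: golfing => //; first exact: tangent_idem.
  exact: tangent_delta_norms_le.
apply: golfing => //; first by rewrite mulr_gt0.
  exact: tangent_svd.
exact: svd_norms_le.
Qed.

Lemma recovery_prob : (0 < m <= n1 * n2)%N ->
  q * (2 * k%:R * (n1 * n2)%:R) <= m%:R ->
  1 - 2 * ((n1 * n2).+1%:R * (k%:R * dl)) <=
  uniform_pr R m (fun Omega =>
    argmin (rstar r) (feasible Omega X) = [set X]%classic /\
    strong_duality r (indicator R (feasible Omega X))).
Proof.
move=> /andP[m0 mN] qm; have [P01 Pk] := union_rate_bounds q01 k.
pose F (Omega : {set 'I_n1 * 'I_n2}) : bool := `[< ~ certified U s V Omega >].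
have cE : #|{: 'I_n1 * 'I_n2}| = (n1 * n2)%N by rewrite card_prod !card_ord.
have Fmon (S T : {set 'I_n1 * 'I_n2}) : S \subset T -> F T -> F S.
  by move=> ST /asboolP nT; apply/asboolP => cS; apply: nT; apply: certified_sub cS.
have PN : union_rate q k * #|{: 'I_n1 * 'I_n2}|%:R <= m%:R / 2.
  rewrite cE ler_pdivlMr ?ltr0n //.
  apply: le_trans qm.
  have := ler_wpM2r (ler0n R (n1 * n2)) Pk; lra.
have mE : (0 < m <= #|{: 'I_n1 * 'I_n2}|)%N by rewrite m0 cE.
have H := uniform_le_bern Fmon mE P01 PN.
have H2 := le_trans H (ler_wpM2l (ler0n R 2) certified_bern).
have lE : #|[pred Omega : {set 'I_n1 * 'I_n2} | #|Omega| == m]|%:R =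
    level (fun _ : {set 'I_n1 * 'I_n2} => 1 : R) m.
  by rewrite -sum1_card natr_sum.
have l0 : 0 < level (fun _ : {set 'I_n1 * 'I_n2} => 1 : R) m.
  by apply: level1_gt0; case/andP: mE.
rewrite /uniform_pr lE ler_pdivlMr //.
have : 1 - 2 * ((n1 * n2).+1%:R * (k%:R * dl)) <=
    1 - level (fun Omega => (F Omega)%:R) m / level (fun _ : {set 'I_n1 * 'I_n2} => 1) m by apply: lerB.
move/(ler_wpM2r (ltW l0)) => /le_trans; apply.
rewrite mulrBl mul1r divfK ?gt_eqF // /level -sumrB -sum1_card natr_sum.
rewrite big_mkcond /= [leRHS]big_mkcond /=; apply: ler_sum => Omega _.
rewrite !inE; case: eqP => //= _.
case: (asboolP (_ /\ _)) => [_|nE]; first by rewrite gerBl.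
have -> : F Omega; last by rewrite subrr.
by apply/asboolP => c; apply: nE; apply: certified_recovery c.
Qed.

End Probability.

(** * Numerical estimates *)

Section Constants.
Variable R : realType.

Lemma ln2_ge : 2^-1 <= ln 2 :> R.
Proof.
have h : -1 < - 2^-1 :> R by lra.
have := le_ln1Dx h.
have -> : 1 + - 2^-1 = 2^-1 :> R by lra.
by rewrite lnV ?posrE //; lra.
Qed.

Lemma ln_ge1 (x : R) : 4 <= x -> 1 <= ln x.
Proof.
move=> x4; apply: le_trans (_ : ln (2 ^+ 2) <= _).
  by rewrite lnXn // mulr2n; have := ln2_ge; lra.
by rewrite ler_ln ?posrE ?exprn_gt0 //; [rewrite -natrX; apply: le_trans x4; lra | lra].
Qed.

Lemma ln_le (x : R) : 0 < x -> ln x <= x.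
Proof.
move=> x0; have h : -1 < x - 1 by lra.
have := le_ln1Dx h.
by rewrite addrC subrK; lra.
Qed.

Lemma exists_pow2 (a : R) : 1 <= a -> exists j, a <= (2 ^ j)%:R <= 2 * a.
Proof.
move=> a1; have a0 : 0 <= a by lra.
have /andP[ta at'] := truncn_itv a0.
have t0 : (0 < Num.truncn a)%N by rewrite truncn_gt0.
have /andP[l1 l2] := trunc_log_bounds (isT : (1 < 2)%N) t0.
exists (trunc_log 2 (Num.truncn a)).+1; apply/andP; split.
  by apply: ltW; apply: lt_le_trans at' _; rewrite ler_nat.
rewrite expnS natrM ler_wpM2l //; apply: le_trans ta; by rewrite ler_nat.
Qed.

(** The squared row norms of [U] sum to [r], so [r <= mu * r]. A negative [mu] is excluded on the
    way: its square root would be 0, contradicting [0 < r]. *)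
Lemma incoherence_rows n r (U : 'M[R]_(n, r)) (mu : R) : (0 < r)%N ->
  U^T *m U = 1%:M ->
  (forall i : 'I_n, fnorm (U^T *m (delta_mx i 0 : 'cV_n)) <= Num.sqrt (mu * r%:R / n%:R)) ->
  1 <= mu * r%:R /\ forall i, sqn (row i U) <= mu * r%:R / n%:R.
Proof.
move=> r0 UU inc; set x := mu * r%:R / n%:R.
have rowle i : sqn (row i U) <= Num.sqrt x ^+ 2.
  rewrite -sqn_tr tr_row colE -fnorm_sqn lerXn2r ?nnegrE ?sqrtr_ge0 //.
have n0 : (0 < n)%N by apply: leq_trans (orth_width UU).
have n0' : 0 < n%:R :> R by rewrite ltr0n.
have rn : r%:R <= Num.sqrt x ^+ 2 * n%:R.
  rewrite -(sqn_orth UU) sqn_sum_rows.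
  apply: le_trans (ler_sum _ (fun i _ => rowle i)) _.
  by rewrite sumr_const card_ord mulr_natr.
have r0' : 1 <= r%:R :> R by rewrite ler1n.
have x0 : 0 <= x.
  rewrite leNgt; apply/negP => xneg; move: rn.
  by rewrite ler0_sqrtr ?(ltW xneg) // expr0n mul0r; lra.
rewrite sqr_sqrtr // in rn rowle.
by split=> //; apply: le_trans r0' _; move: rn; rewrite /x divfK ?gt_eqF.
Qed.

(** As [m] cannot exceed [n ^+ 2], the sample bound yields [c * ka ^+ 2 <= n * b], and [b <= 2 * ka]
    cancels one [ka]. The conclusion makes the logarithm in base [2 kappa] at least 1, so rounding
    the number of steps is harmless. *)
Lemma sampling_bounds (c ka rho a b n N m : R) :
  4 <= c -> 1 <= ka -> 1 <= rho -> 1 <= a -> 0 < b -> b <= 2 * ka -> 0 < n ->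
  N <= n ^+ 2 -> m <= N -> c * ka ^+ 2 * rho * n * (a / b) * a <= m ->
  2 * ka <= n.
Proof.
move=> c4 k1 r1 a1 b0 bk n0 Nn mN cm.
have H : c * ka ^+ 2 * rho * n * (a / b) * a <= n ^+ 2 by apply: le_trans cm (le_trans mN Nn).
have H1 : c * ka ^+ 2 * rho * a ^+ 2 <= n * b.
  rewrite -(ler_pM2l n0); have := ler_wpM2r (ltW b0) H.
  have -> : c * ka ^+ 2 * rho * n * (a / b) * a * b = n * (c * ka ^+ 2 * rho * a ^+ 2).
    by field; rewrite gt_eqF.
  by have -> : n ^+ 2 * b = n * (n * b) by ring.
have k0 : 0 < ka by lra.
have H2 : c * ka * (rho * a ^+ 2) <= 2 * n.
  rewrite -(ler_pM2l k0); have nb := ler_wpM2l (ltW n0) bk.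
  have -> : ka * (c * ka * (rho * a ^+ 2)) = c * ka ^+ 2 * rho * a ^+ 2 by ring.
  lra.
have ra : 1 <= rho * a ^+ 2.
  by rewrite -[leLHS]mulr1 ler_pM // expr2 -[leLHS]mulr1 ler_pM.
have ck : 4 * ka <= c * ka by rewrite ler_wpM2r ?(ltW k0).
have ck0 : 0 <= c * ka by rewrite mulr_ge0 ?(ltW k0) //; move: c4; clear; lra.
have := ler_wpM2l ck0 ra; lra.
Qed.

End Constants.

Local Open Scope classical_set_scope.
Local Open Scope ring_scope.

Theorem theorem3 (R : realType) :
  exists c c0 : R, [/\ 0 < c, 0 < c0 &
    forall (n1 n2 r m : nat) (mu : R) (Xs : 'M[R]_(n1, n2))
      (U : 'M[R]_(n1, r)) (s : 'rV[R]_r) (V : 'M[R]_(n2, r)),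
    let n := maxn n1 n2 in
    let kappa := condition_number Xs in
    (0 < r)%N ->
    \rank Xs = r ->
    skinny_svd Xs U s V ->
    incoherent mu U V ->
    (m <= n1 * n2)%N ->
    c * kappa ^+ 2 * mu * r%:R * n%:R * logb (2 * kappa) n%:R * ln n%:R
      <= m%:R ->
    1 - c0 * n%:R ^- 10 <=
      uniform_pr R m (fun Omega : {set 'I_n1 * 'I_n2} =>
        argmin (rstar r) (feasible Omega Xs) = [set Xs] /\
        strong_duality r (indicator R (feasible Omega Xs)))].
Proof.
(* [th = 1 / (8 kappa)] is the contraction factor of a golfing step, [k] the
   number of steps, and [K] makes each tail probability at most [n^-20]. *)
pose K : R := expR 10; have K1 : 1 <= K.
  by have := expR_ge1Dx (10 : R); rewrite -/K; lra.
(* The first constant makes [rate] hold, with 6 paying for the roundings of [2 ^ j0] and [k]. The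
   second makes the claim trivial for [n < 4], so that [ln n] is at least 1 in the remaining
   case. *)
exists (6 * 2 ^+ 12 * K ^+ 2), (4 ^+ 10).
have K0 : 0 < K by rewrite expR_gt0.
split; [by rewrite !mulr_gt0 ?exprn_gt0 | by rewrite exprn_gt0 |].
move=> n1 n2 r m mu Xs U s V n kappa r0 rk [UU VV s0 sS XE] [iU iV] mN hm.
have n1r := orth_width UU; have n2r := orth_width VV.
have n1p : (0 < n1)%N by apply: leq_trans n1r.
have n2p : (0 < n2)%N by apply: leq_trans n2r.
have n1n : (n1 <= n)%N by rewrite leq_maxl.
have n2n : (n2 <= n)%N by rewrite leq_maxr.
have np : (0 < n)%N by apply: leq_trans n1n.
have nR : 0 < n%:R :> R by rewrite ltr0n.
have n1R : 0 < n1%:R :> R by rewrite ltr0n.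
have n2R : 0 < n2%:R :> R by rewrite ltr0n.
have [n4|n4] := ltnP n 4.
  apply: le_trans (_ : 0 <= _); last by rewrite /uniform_pr divr_ge0.
  rewrite subr_le0 ler_pdivlMr ?exprn_gt0 // mul1r lerXn2r ?nnegrE // ler_nat.
  exact: ltnW.
have [rho1 Uw] := incoherence_rows r0 UU iU.
have [_ Vw] := incoherence_rows r0 VV iV.
set rho := mu * r%:R in rho1 Uw Vw.
pose i0 : 'I_r := Ordinal r0.
have r1r : (r.-1 < r)%N by rewrite prednK.
pose i1 : 'I_r := Ordinal r1r.
pose s1 := s 0 i0; pose sr := s 0 i1.
have s1p : 0 < s1 by apply: s0.
have srp : 0 < sr by apply: s0.
have s_le i : s 0 i <= s1 by apply: sS.
have s_ge i : sr <= s 0 i by apply: sS; rewrite /= -ltnS prednK.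
have kE : kappa = s1 / sr.
  rewrite /kappa /condition_number rk XE /s1 /sr.
  by rewrite -(sigma_svd UU VV s0 i0 sS) -(sigma_svd UU VV s0 i1 sS).
have k1 : 1 <= kappa by rewrite kE ler_pdivlMr // mul1r; apply: s_le.
have k0 : 0 < kappa by move: k1; clear; lra.
have k20 : 0 < 2 * kappa by rewrite mulr_gt0.
pose a : R := ln n%:R; pose b : R := ln (2 * kappa).
have a1 : 1 <= a by apply: ln_ge1; rewrite ler_nat.
have b12 : 2^-1 <= b.
  by apply: le_trans (ln2_ge R) _; rewrite ler_ln ?posrE //; move: k1; clear; lra.
have b0 : 0 < b by move: b12; clear; lra.
have bk : b <= 2 * kappa by apply: ln_le.
pose L := a / b.
pose N : R := (n1 * n2)%:R.
have N0 : 0 < N by rewrite ltr0n muln_gt0 n1p.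
have Nn : N <= n%:R ^+ 2 by rewrite -natrX ler_nat -mulnn leq_mul.
have mNR : m%:R <= N by rewrite ler_nat.
have [c cE] : exists c : R, c = 6 * 2 ^+ 12 * K ^+ 2 by eexists.
have c4 : 4 <= c.
  have : 1 <= 2 ^+ 12 :> R by rewrite exprn_ege1 // ler1n.
  move/(mulr_ege1 (exprn_ege1 2 K1)); rewrite cE; clear; lra.
have hm' : c * kappa ^+ 2 * rho * n%:R * L * a <= m%:R.
  by move: hm; rewrite /logb -/a -/b -/L -cE -(mulrA _ mu) -/rho.
have kn : 2 * kappa <= n%:R.
  by apply: (sampling_bounds c4 k1 rho1 a1 b0 bk nR Nn mNR hm').
have ba : b <= a by rewrite ler_ln ?posrE.
have L1 : 1 <= L by rewrite ler_pdivlMr // mul1r.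
have ck1 : 1 <= c * kappa ^+ 2 * L * a.
  have c1 : 1 <= c by move: c4; clear; lra.
  have kk : 1 <= kappa ^+ 2 by apply: exprn_ege1.
  exact: mulr_ege1 (mulr_ege1 (mulr_ege1 c1 kk) L1) a1.
have rho0 : 0 < rho by apply: lt_le_trans rho1.
have rn0 : 0 < rho * n%:R by rewrite mulr_gt0.
(* This is [rho / minn n1 n2], the larger of the two incoherence bounds. *)
pose w2 := rho * n%:R / N.
have w20 : 0 < w2 by rewrite divr_gt0.
pose w := Num.sqrt w2.
have wE : w ^+ 2 = w2 by rewrite sqr_sqrtr // ltW.
(* The sample bound gives [rho * n <= m <= N], which is what makes [w <= 1]. *)
have rnN : rho * n%:R <= N.
  apply: le_trans mNR; apply: le_trans hm'.
  have := ler_wpM2l (ltW rn0) ck1; clear; lra.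
have w01 : 0 < w <= 1.
  by rewrite sqrtr_gt0 w20 -[leRHS]sqrtr1 ler_wsqrtr // ler_pdivrMr // mul1r.
have Uw' i : sqn (row i U) <= w ^+ 2.
  apply: le_trans (Uw i) _; rewrite wE /w2 /N natrM.
  have -> : rho * n%:R / (n1%:R * n2%:R) = rho / n1%:R * (n%:R / n2%:R).
    by field; rewrite !gt_eqF.
  rewrite ler_peMr ?divr_ge0 ?(ltW n1R) ?(ltW rho0) //.
  by rewrite ler_pdivlMr // mul1r ler_nat.
have Vw' j : sqn (row j V) <= w ^+ 2.
  apply: le_trans (Vw j) _; rewrite wE /w2 /N natrM.
  have -> : rho * n%:R / (n1%:R * n2%:R) = rho / n2%:R * (n%:R / n1%:R).
    by field; rewrite !gt_eqF.
  rewrite ler_peMr ?divr_ge0 ?(ltW n2R) ?(ltW rho0) //.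
  by rewrite ler_pdivlMr // mul1r ler_nat.
have L0 : 0 <= L by apply: le_trans L1.
have [k [k_gt0 kL k3]] : exists k : nat, [/\ (0 < k)%N, 2 * L <= k%:R & k%:R <= 3 * L].
  have /andP[tL Lt] := truncn_itv (mulr_ge0 (ler0n R 2) L0).
  exists (Num.truncn (2 * L)).+1; split=> //; first exact: ltW.
  by rewrite -natr1; move: tL L1; clear; lra.
have kp : 0 < k%:R :> R by rewrite ltr0n.
pose th := (8 * kappa)^-1.
have th01 : 0 < th <= 2^-1.
  have k8 : 2 <= 8 * kappa by move: k1; clear; lra.
  have k80 : 0 < 8 * kappa by rewrite mulr_gt0.
  by rewrite /th invr_gt0 k80 /= lef_pV2 ?posrE.
have th_s i : 4 * th * s1 < s 0 i.
  apply: lt_le_trans (s_ge i).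
  have -> : 4 * th * s1 = sr / 2 by rewrite /th kE; field; rewrite !gt_eqF.
  by move: srp; clear; lra.
have small : (n1 * n2)%:R * (4 * th ^+ k * w) <= 1.
  have [w0 w1] := andP w01.
  have pw : n%:R ^+ 2 <= (2 * kappa) ^+ k.
    suff : ln (n%:R ^+ 2) <= ln ((2 * kappa) ^+ k) by rewrite ler_ln ?posrE ?exprn_gt0.
    rewrite (lnXn _ nR) (lnXn _ k20) -/a -/b -(mulr_natl b) -(mulr_natl a).
    by move: kL; rewrite /L mulrA ler_pdivrMr.
  have thk : th ^+ k = (4 ^+ k * (2 * kappa) ^+ k)^-1.
    by rewrite -exprMn /th exprVn; congr (_ ^+ _)^-1; ring.
  have pos : 0 < 4 ^+ k * (2 * kappa) ^+ k by rewrite mulr_gt0 ?exprn_gt0.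
  (* Of [8 * kappa = 4 * (2 * kappa)], the powers of [2 * kappa] beat [N <= n ^ 2] and those of 4
     absorb the factor 4, as [k] is positive. *)
  rewrite thk; apply: le_trans (_ : N * (4 / (4 ^+ k * (2 * kappa) ^+ k)) <= _).
    by rewrite ler_wpM2l ?(ltW N0) // ler_piMr // divr_ge0 ?(ltW pos).
  rewrite mulrA ler_pdivrMr // mul1r mulrC ler_pM ?(ltW N0) //.
    by rewrite -[leLHS]expr1 ler_weXn2l // ler1n.
  exact: le_trans Nn pw.
pose q := m%:R / (2 * k%:R * N).
have kN0 : 0 < 2 * k%:R * N by rewrite !mulr_gt0.
have m0 : 0 < m%:R :> R.
  have a0 : 0 < a by apply: lt_le_trans a1.
  have Lp : 0 < L by apply: lt_le_trans L1.
  have c0 : 0 < c by apply: lt_le_trans c4.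
  apply: lt_le_trans hm'.
  exact: mulr_gt0 (mulr_gt0 (mulr_gt0 (mulr_gt0 (mulr_gt0 c0 (exprn_gt0 2 k0)) rho0) nR) Lp) a0.
have q01 : 0 < q <= 1.
  rewrite divr_gt0 //= ler_pdivrMr // mul1r; apply: le_trans mNR _.
  rewrite ler_peMl ?(ltW N0) //.
  have : 1 <= k%:R :> R by rewrite ler1n.
  clear; lra.
have [j0 /andP[aj ja]] := exists_pow2 a1.
have rate : (2 * K) ^+ 2 * (2 ^ j0).*2%:R * (4 * w ^+ 2) <= th ^+ 2 * q.
  rewrite wE -mul2n natrM.
  (* [2 ^+ 7] is 64 from [th ^+ 2] times 2 from [q]; the left side contributes another [2 ^+ 5],
     whence the [2 ^+ 12] in [c]. *)
  have -> : th ^+ 2 * q = m%:R / (2 ^+ 7 * kappa ^+ 2 * k%:R * N).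
    by rewrite /th /q; field; rewrite !gt_eqF.
  have p7 : 0 < 2 ^+ 7 :> R by rewrite exprn_gt0.
  rewrite ler_pdivlMr; last exact: mulr_gt0 (mulr_gt0 (mulr_gt0 p7 (exprn_gt0 2 k0)) kp) N0.
  apply: le_trans hm'.
  have -> : (2 * K) ^+ 2 * (2 * (2 ^ j0)%:R) * (4 * w2) * (2 ^+ 7 * kappa ^+ 2 * k%:R * N) =
      2 ^+ 12 * K ^+ 2 * kappa ^+ 2 * rho * n%:R * ((2 ^ j0)%:R * k%:R).
    by rewrite /w2; field; rewrite !gt_eqF.
  have -> : c * kappa ^+ 2 * rho * n%:R * L * a =
      2 ^+ 12 * K ^+ 2 * kappa ^+ 2 * rho * n%:R * (2 * a * (3 * L)).
    by rewrite cE; ring.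
  rewrite ler_wpM2l ?ler_pM ?(ltW kp) //.
  have p12 : 0 < 2 ^+ 12 :> R by rewrite exprn_gt0.
  exact: ltW (mulr_gt0 (mulr_gt0 (mulr_gt0 (mulr_gt0 p12 (exprn_gt0 2 K0)) (exprn_gt0 2 k0)) rho0) nR).
have m0n : (0 < m <= n1 * n2)%N by rewrite mN andbT -(ltr0n R).
have qm : q * (2 * k%:R * (n1 * n2)%:R) <= m%:R by rewrite divfK ?gt_eqF.
have := recovery_prob UU VV s0 w01 Uw' Vw' q01 K1 th01 rate s1p s_le small th_s m0n qm.
rewrite -XE; apply: le_trans; apply: lerB => //.
pose l := (2 ^ j0).*2.
have Kl : K^-1 ^+ l <= n%:R ^- 10 * n%:R ^- 10.
  rewrite exprVn -invfM -exprD lef_pV2 ?posrE ?exprn_gt0 //.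
  have nE : n%:R = expR a by rewrite lnK.
  rewrite nE /K -!expRM_natl ler_expR /l -mul2n natrM.
  by move: aj; clear; lra.
have N1 : (n1 * n2).+1%:R <= 2 * n%:R ^+ 2 :> R.
  rewrite -natr1; have : 1 <= n%:R ^+ 2 :> R by rewrite exprn_ege1 // ler1n.
  by move: Nn; rewrite /N; clear; lra.
have k6 : k%:R <= 6 * n%:R :> R.
  have an : a <= n%:R by apply: ln_le.
  apply: le_trans k3 _; rewrite /L mulrA ler_pdivrMr //.
  have := ler_wpM2l (ltW nR) b12; move: an; clear; lra.
have D8 : (n1.+1 ^ 2 * n2.+1)%:R <= 8 * n%:R ^+ 3 :> R.
  have -> : 8 * n%:R ^+ 3 = ((2 * n) ^ 2 * (2 * n))%:R :> R by rewrite natrM natrX natrM; ring.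
  have S2 i : (i <= n)%N -> (i.+1 <= 2 * n)%N by move=> iN; rewrite mul2n -addnn -addn1 leq_add.
  by rewrite ler_nat leq_mul ?leq_exp2r ?S2.
have n10 : 0 < n%:R ^- 10 :> R by rewrite invr_gt0 exprn_gt0.
(* The factors are the passage to uniform sets, the starting matrices, the steps, the events per
   step and their tail: [192 * n ^ 6] against [n ^ -20]. *)
apply: le_trans (_ : 2 * (2 * n%:R ^+ 2 * (6 * n%:R * (8 * n%:R ^+ 3 * (n%:R ^- 10 * n%:R ^- 10)))) <= _).
  rewrite ler_wpM2l // ler_pM // ?ler_pM //.
  - by rewrite !mulr_ge0 ?exprn_ge0 ?invr_ge0 ?(ltW K0).
  - by rewrite mulr_ge0 ?exprn_ge0 ?invr_ge0 ?(ltW K0).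
  - by rewrite exprn_ge0 ?invr_ge0 ?(ltW K0).
have -> : 2 * (2 * n%:R ^+ 2 * (6 * n%:R * (8 * n%:R ^+ 3 * (n%:R ^- 10 * n%:R ^- 10)))) =
    192 * (n%:R ^+ 6 * n%:R ^- 10) * n%:R ^- 10 :> R by ring.
rewrite ler_wpM2r ?(ltW n10) //.
have n6 : n%:R ^+ 6 * n%:R ^- 10 <= 1 :> R.
  by rewrite ler_pdivrMr ?exprn_gt0 // mul1r ler_weXn2l // ler1n.
have -> : 4 ^+ 10 = 4 ^+ 4 * 4 ^+ 6 :> R by rewrite -exprD.
have c1 : 1 <= 4 ^+ 6 :> R by rewrite exprn_ege1 // ler1n.
have -> : 4 ^+ 4 = 256 :> R by ring.
by move: n6 c1; clear; lra.
Qed.
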